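(* Let $k\ge2$, $d=k(k+1)/2$, $r=r_k$, let $\nu=\nu_0+\nu_1+\nu_2$ be the Kusuoka measure on $SG_k$, $R_i=d\nu_i/d\nu$, and for $j=0,\dots,d-1$ let $Q_j=\sum_{i=0}^2S^j_iR_i$, where $S^j_i$ is the sum of column $i$ of the matrix $M_j$ defined below. If $u\in\operatorname{dom}\Delta_\nu$, then for each $j$ the function $u\circ F_j$ satisfies $$\Delta_\nu(u\circ F_j)=r\,Q_j\,(\Delta_\nu u)\circ F_j\qquad\nu\text{-almost everywhere},$$ in the weak sense that $\mathcal E(u\circ F_j,v)=-\int_K r\,Q_j\,(\Delta_\nu u)\circ F_j\,v\,d\nu$ for all $v\in\operatorname{dom}_0\mathcal E$.
   Context: Let $q_0,q_1,q_2$ be the vertices of a unit equilateral triangle $T\subset\mathbb R^2$. Fix $k\ge2$ and $d=k(k+1)/2$. Let $F_n(x)=x/k+b_n$, $n=0,\dots,d-1$, be the similitudes mapping $T$ onto the $d$ triangles of side $1/k$ with the same orientation as $T$ in the subdivision of $T$ into $k^2$ triangles. $SG_k$ is $K=\bigcup_nF_n(K)$. Notation: $F_w=F_{w_1}\circ\cdots\circ F_{w_m}$, $V_0=\{q_0,q_1,q_2\}$, $V_m=\bigcup_{|w|=m}F_w(V_0)$. The graph $\Gamma_m$ has $x\sim_my$ iff $x\ne y$ and $x,y\in F_w(V_0)$ for some $|w|=m$. Energy: $\mathcal E_m(u)=r^{-m}\sum_{x\sim_my}(u(x)-u(y))^2$, where $r=r_k$ is the unique $r>0$ with $\min\{\mathcal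 E_1(\tilde u):\tilde u|_{V_0}=u\}=\mathcal E_0(u)$ for all $u$ on $V_0$. Then $\mathcal E(u)=\lim_m\mathcal E_m(u|_{V_m})$, $\operatorname{dom}\mathcal E=\{u\in C(K):\mathcal E(u)<\infty\}$, $\operatorname{dom}_0\mathcal E$ consists of those vanishing on $V_0$, and $\mathcal E(u,v)$ is the bilinear form. A function $h$ is harmonic if $\mathcal E_m(h|_{V_m})=\mathcal E_0(h|_{V_0})$ for all $m$. $h_i$ is harmonic with $h_i(q_j)=\delta_{ij}$. Energy measures: $\nu_u(F_wK)=r^{-|w|}\mathcal E(u\circ F_w)$, and $\nu_i=\nu_{h_i}$. Laplacian: $u\in\operatorname{dom}\Delta_\nu$ with $\Delta_\nu u=f$ ($f$ continuous) iff $u\in\operatorname{dom}\mathcal E$ and $\mathcal E(u,v)=-\int_Kfv\,d\nu$ for all $v\in\operatorname{dom}_0\mathcal E$. $p^j_{ni}$ is the probability that the simple random walk on $\Gamma_1$ started at $F_n(q_i)$ hits $q_j$ before the other two points of $V_0$. The matrix $M_n=[\mu^n_{ji}]$ has entries $\mu^n_{j0}=\frac1r((p^j_{n0})^2-p^j_{n0}p^j_{n1}-p^j_{n0}p^j_{n2}+p^j_{n1}p^j_{n2})$, $\mu^n_{j1}=\frac1r((p^j_{n1})^2-p^j_{n0}p^j_{n1}+p^j_{n0}p^j_{n2}-p^j_{n1}p^j_{n2})$, $\mu^n_{j2}=\frac1r((p^j_{n2})^2+p^j_{n0}p^j_{n1}-p^j_{n0}p^j_{n2}-p^j_{n1}p^j_{n2})$.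 *)

(* Defs.v *)
From HB Require Import structures.
From mathcomp Require Import all_boot all_order all_algebra.
From mathcomp Require Import all_classical all_reals all_analysis.
Set Implicit Arguments. Unset Strict Implicit. Unset Printing Implicit Defensive.
Import Order.TTheory GRing.Theory Num.Theory.
Import numFieldNormedType.Exports.
Local Open Scope classical_set_scope.
Local Open Scope ring_scope.

Section SGk.
Variable R : realType.
Notation pt := (R * R)%type.

Definition qv (i : nat) : pt :=
  match i with
  | 0%N => (0, 0)
  | 1%N => (1, 0)
  | _ => (2^-1, Num.sqrt 3 / 2)
  end.

Definition V0 : seq pt := [:: qv 0; qv 1; qv 2].

Definition dk (k : nat) : nat := (k * k.+1)./2.

(* upward subtriangles of side 1/k: lower-left corner (a q1 + c q2)/k,
   a + c <= k-1; enumerated in a fixed order, n = 0..d-1 *)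
Definition cells (k : nat) : seq (nat * nat) :=
  flatten [seq [seq (a, c) | c <- iota 0 (k - a)] | a <- iota 0 k].

Definition bvec (k n : nat) : pt :=
  let ac := nth (0%N, 0%N) (cells k) n in
  ((ac.1%:R * (qv 1).1 + ac.2%:R * (qv 2).1) / k%:R,
   (ac.1%:R * (qv 1).2 + ac.2%:R * (qv 2).2) / k%:R).

Definition Sim (k n : nat) (x : pt) : pt :=
  (x.1 / k%:R + (bvec k n).1, x.2 / k%:R + (bvec k n).2).

Definition Fw (k : nat) (w : seq nat) (x : pt) : pt := foldr (Sim k) x w.

Fixpoint words (k m : nat) : seq (seq nat) :=
  match m with
  | 0%N => [:: [::]]
  | m'.+1 => [seq n :: w | n <- iota 0 (dk k), w <- words k m']
  end.

Definition cellpts (k : nat) (w : seq nat) : seq pt := map (Fw k w) V0.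

Definition Vm (k m : nat) : seq pt := undup (flatten (map (cellpts k) (words k m))).

Definition adj (k m : nat) (x y : pt) : bool :=
  (x != y) && has (fun w => (x \in cellpts k w) && (y \in cellpts k w)) (words k m).

(* E_m(u) = r^{-m} sum over edges (unordered pairs) of (u x - u y)^2 *)
Definition Em (k : nat) (r : R) (m : nat) (u : pt -> R) : R :=
  r ^- m * (2^-1 * \sum_(x <- Vm k m) \sum_(y <- Vm k m | adj k m x y) (u x - u y) ^+ 2).

Definition Em2 (k : nat) (r : R) (m : nat) (u v : pt -> R) : R :=
  r ^- m * (2^-1 * \sum_(x <- Vm k m) \sum_(y <- Vm k m | adj k m x y)
                     (u x - u y) * (v x - v y)).

Definition is_renorm (k : nat) (r : R) : Prop :=
  0 < r /\
  forall u : pt -> R,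
    exists ut : pt -> R,
      (forall i, (i < 3)%N -> ut (qv i) = u (qv i)) /\
      Em k r 1 ut = Em k r 0 u /\
      (forall vt : pt -> R, (forall i, (i < 3)%N -> vt (qv i) = u (qv i)) ->
         Em k r 1 ut <= Em k r 1 vt).

Definition is_SG (k : nat) (K : set pt) : Prop :=
  compact K /\ K !=set0 /\
  K = \bigcup_(n in [set n : nat | (n < dk k)%N]) (Sim k n @` K).

Definition in_domE (k : nat) (r : R) (K : set pt) (u : pt -> R) : Prop :=
  {within K, continuous u} /\ cvgn (fun m => Em k r m u).

Definition energy (k : nat) (r : R) (u : pt -> R) : R := limn (fun m => Em k r m u).

Definition energy2 (k : nat) (r : R) (u v : pt -> R) : R :=
  limn (fun m => Em2 k r m u v).

Definition in_domE0 (k : nat) (r : R) (K : set pt) (v : pt -> R) : Prop :=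
  in_domE k r K v /\ forall i, (i < 3)%N -> v (qv i) = 0.

Definition harmonic_basis (k : nat) (r : R) (K : set pt) (i : nat) (h : pt -> R) : Prop :=
  {within K, continuous h} /\
  (forall m, Em k r m h = Em k r 0 h) /\
  (forall j, (j < 3)%N -> h (qv j) = (i == j)%:R).

Definition is_energy_measure (k : nat) (r : R) (K : set pt) (u : pt -> R)
    (mu : {measure set pt -> \bar R}) : Prop :=
  mu (~` K) = 0%E /\
  forall w : seq nat, all (fun n => (n < dk k)%N) w ->
    mu (Fw k w @` K) = (r ^- size w * energy k r (u \o Fw k w))%:E.

Definition is_density (nui nu : {measure set pt -> \bar R}) (Rf : pt -> R) : Prop :=
  measurable_fun setT Rf /\
  forall A : set pt, measurable A -> nui A = (\int[nu]_(x in A) (Rf x)%:E)%E.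

Definition laplacian (k : nat) (r : R) (K : set pt) (nu : {measure set pt -> \bar R})
    (u f : pt -> R) : Prop :=
  {within K, continuous f} /\ in_domE k r K u /\
  forall v, in_domE0 k r K v ->
    (energy2 k r u v)%:E = (- \int[nu]_(x in K) (f x * v x)%:E)%E.

Definition deg1 (k : nat) (x : pt) : nat := count (adj k 1 x) (Vm k 1).

Fixpoint allseqs (s : seq pt) (n : nat) : seq (seq pt) :=
  match n with
  | 0%N => [:: [::]]
  | n'.+1 => [seq x :: p | x <- s, p <- allseqs s n']
  end.

(* probability that the walk follows the path x :: p *)
Fixpoint path_weight (k : nat) (x : pt) (p : seq pt) : R :=
  match p with
  | [::] => 1
  | y :: p' => ((adj k 1 x y)%:R / (deg1 k x)%:R) * path_weight k y p'
  end.

(* probability that the walk started at s first hits V0 at time n, at q_j *)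
Definition hit_at (k j : nat) (s : pt) (n : nat) : R :=
  \sum_(p <- allseqs (Vm k 1) n)
    (if all (fun x => x \notin V0) (take n (s :: p)) && (last s p == qv j)
     then path_weight k s p else 0).

Definition phit (k j : nat) (s : pt) : R :=
  limn (fun N => \sum_(0 <= n < N) hit_at k j s n).

Definition pjni (k j n i : nat) : R := phit k j (Sim k n (qv i)).

Definition muM (k : nat) (r : R) (n j i : nat) : R :=
  let p0 := pjni k j n 0 in let p1 := pjni k j n 1 in let p2 := pjni k j n 2 in
  match i with
  | 0%N => r^-1 * (p0 ^+ 2 - p0 * p1 - p0 * p2 + p1 * p2)
  | 1%N => r^-1 * (p1 ^+ 2 - p0 * p1 + p0 * p2 - p1 * p2)
  | _   => r^-1 * (p2 ^+ 2 + p0 * p1 - p0 * p2 - p1 * p2)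
  end.

Definition Scol (k : nat) (r : R) (n i : nat) : R := \sum_(j < 3) muM k r n j i.

Definition Qfun (k : nat) (r : R) (n : nat) (R0 R1 R2 : pt -> R) (x : pt) : R :=
  Scol k r n 0 * R0 x + Scol k r n 1 * R1 x + Scol k r n 2 * R2 x.

End SGk.

(* Main.v *)
(** Let [v'] be [v o F_j^-1] on [F_j K] and 0 elsewhere. Since cells meet only at
    corners, where [v] vanishes, [v'] is again in [dom_0 E], and self-similarity of
    the energy gives [E(u o F_j, v) = r E(u, v') = - r \int_(F_j K) f (v o F_j^-1) d nu].
    It remains to see that pulling [nu] back by [F_j] multiplies it by [Q_j]. On a
    cell [F_w K] this is an identity between energies of [h_l o F_j o F_w]: a
    harmonic function is determined by its corner values through the hitting
    probabilities, so [h_l o F_j] is a combination of [h_0, h_1, h_2], and polarising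
    with [h_0 + h_1 + h_2 = 1] yields the entries of [M_j]. Cells of a given level
    overlap in null sets because their masses add up, so integrals of continuous
    functions are limits of Riemann sums over cells, and the cell identity passes
    to integrals. *)
Require Import Defs.
From HB Require Import structures.
From mathcomp Require Import all_boot all_order all_algebra.
From mathcomp Require Import all_classical all_reals all_analysis measurable_realfun.
From mathcomp Require Import zify ring lra.
Set Implicit Arguments.
Unset Strict Implicit.
Unset Printing Implicit Defensive.
Import Order.TTheory GRing.Theory Num.Theory.
Import numFieldNormedType.Exports.
Local Open Scope classical_set_scope.
Local Open Scope ring_scope.

(** The graphs are built on points of the plane, so which corners of which cells coincide must be
    decided before any energy can be computed. In the basis [q_1, q_2], scaled by k^m, the corners
    of level m are integer points; a directed edge then determines its cell, and E_m becomes a sum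
    over words of one quadratic form in three corner values. The set K enters only as some nonempty
    compact solution of the self-similarity equation: its position in the triangle and its
    containing the corners come from extremum arguments. Hitting probabilities give the harmonic
    extension because the difference of the two functions is E_1-orthogonal to both. The cell
    identity for nu carries coefficients S^j_i of unknown sign, so it is not directly an equality of
    two measures to be extended by uniqueness; Riemann sums use only its values on cells, together
    with the fact that F_j carries sample points to sample points. *)

Lemma euclid_inj d q q' s s' : (s < d)%N -> (s' < d)%N ->
  (s + q * d = s' + q' * d)%N -> q = q' /\ s = s'.
Proof.
move=> sd sd'; rewrite ![(_ + _ * _)%N]addnC => /(congr1 (edivn ^~ d)).
by rewrite !edivn_eq // => -[-> ->].
Qed.

(** * Enumeration of cells and base-k addresses of words *)

Section Cells.
Variable k : nat.

Definition cell (n : nat) : nat * nat := nth (0, 0)%N (cells k) n.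

Lemma mem_cells (p : nat * nat) : (p \in cells k) = (p.1 + p.2 < k)%N.
Proof.
case: p => a c /=; apply/flattenP/idP => [[s /mapP[a']]|ack].
  rewrite mem_iota /= add0n => a'k -> /mapP[c'].
  by rewrite mem_iota /= add0n => c'k [-> ->]; lia.
exists [seq (a, c') | c' <- iota 0 (k - a)].
  by apply/mapP; exists a => //; rewrite mem_iota; lia.
by apply/mapP; exists c => //; rewrite mem_iota; lia.
Qed.

Lemma size_cells : size (cells k) = dk k.
Proof.
rewrite /cells /dk size_flatten /shape -map_comp.
under eq_map => a do rewrite /= size_map size_iota.
rewrite sumnE big_map.
have -> : iota 0 k = index_iota 0 k by rewrite /index_iota subn0.
elim: k => [|n IHn]; first by rewrite big_geq.
rewrite big_nat_recl // subn0; under eq_bigr => i _ do rewrite subSS.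
rewrite IHn; have := odd_double_half (n * n.+1); have := odd_double_half (n.+1 * n.+2).
by rewrite !oddM /= !negbK; case: (odd n) => /=; lia.
Qed.

Lemma uniq_cells : uniq (cells k).
Proof.
apply: allpairs_uniq_dep; first exact: iota_uniq.
  by move=> a _; exact: iota_uniq.
by move=> [a c] [a' c'] _ _ [-> ->].
Qed.

Lemma cell_lt n : (n < dk k)%N -> ((cell n).1 + (cell n).2 < k)%N.
Proof. by move=> nk; rewrite -mem_cells mem_nth // size_cells. Qed.

Lemma cell_inj n n' : (n < dk k)%N -> (n' < dk k)%N -> cell n = cell n' -> n = n'.
Proof.
move=> nk n'k /eqP; rewrite nth_uniq ?size_cells ?uniq_cells //; exact/eqP.
Qed.

Lemma cell_surj a c : (a + c < k)%N -> exists2 n, (n < dk k)%N & cell n = (a, c).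
Proof.
move=> ack; have ac : (a, c) \in cells k by rewrite mem_cells.
by exists (index (a, c) (cells k)); [rewrite -size_cells index_mem|rewrite /cell nth_index].
Qed.

Definition valid (w : seq nat) := all (fun n => n < dk k)%N w.

Lemma mem_words m w : (w \in words k m) = (size w == m) && valid w.
Proof.
elim: m w => [|m IHm] [|n w] //=.
- by apply/negbTE/negP => /allpairsP[[n w] []].
- rewrite /= eqSS; apply/allpairsP/idP => [[[n' w'] /= [+ + [-> ->]]]|].
    by rewrite mem_iota IHm => /= -> /andP[-> ->].
  move=> /and3P[sw nk vw]; exists (n, w) => /=; split=> //; first by rewrite mem_iota.
  by rewrite IHm sw.
Qed.

Lemma uniq_words m : uniq (words k m).
Proof.
elim: m => [//|m IHm]; apply: allpairs_uniq => //; first exact: iota_uniq.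
by move=> [n w] [n' w'] _ _ [-> ->].
Qed.

Lemma big_wordsS (V : nmodType) m (F : seq nat -> V) :
  \sum_(w <- words k m.+1) F w =
  \sum_(n <- iota 0 (dk k)) \sum_(w <- words k m) F (n :: w).
Proof.
by rewrite /= big_flatten big_map; apply: eq_bigr => n _; rewrite big_map.
Qed.

(* The corner [F_w q_0] has coordinates [offset w / k ^ |w|] in the basis
   [q_1, q_2]. *)
Fixpoint offset (w : seq nat) : nat * nat :=
  if w is n :: w' then
    ((offset w').1 + (cell n).1 * k ^ size w',
     (offset w').2 + (cell n).2 * k ^ size w')%N
  else (0, 0)%N.

Lemma offset_lt w : valid w ->
  ((offset w).1 < k ^ size w)%N /\ ((offset w).2 < k ^ size w)%N.
Proof.
elim: w => [//|n w IHw] /= /andP[/cell_lt nk /IHw [h1 h2]]; rewrite expnS; nia.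
Qed.

(** In each coordinate the first letter supplies the leading base-k digit, and the contribution of
    the tail stays below its place value by [offset_lt]; Euclidean division therefore recovers the
    letters one by one. *)
Lemma offset_inj w w' : size w = size w' -> valid w -> valid w' ->
  offset w = offset w' -> w = w'.
Proof.
elim: w w' => [[]//|n w IHw] [//|n' w'] /= [sw] /andP[nk vw] /andP[nk' vw'].
have [a1 a2] := offset_lt vw; have [b1 b2] := offset_lt vw'.
rewrite -sw in b1 b2 *; move=> [e1 e2].
have [c1 d1] := euclid_inj a1 b1 e1.
have [c2 d2] := euclid_inj a2 b2 e2.
congr (_ :: _).
  by apply: cell_inj => //; exact: injective_projections.
by apply: IHw => //; exact: injective_projections.
Qed.

End Cells.

(** * Lattice coordinates and coincidences of corners *)

Section Coordinates.
Variable R : realType.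
Notation pt := (R * R)%type.

(* [ca x] and [cb x] are the coordinates of [x] in the basis [q_1, q_2]. *)
Definition ca (x : pt) : R := x.1 - x.2 / Num.sqrt 3.
Definition cb (x : pt) : R := x.2 * 2 / Num.sqrt 3.

Lemma sqrt3_neq0 : Num.sqrt 3 != 0 :> R.
Proof. by rewrite gt_eqF // sqrtr_gt0. Qed.

Lemma coord_inj (x y : pt) : ca x = ca y -> cb x = cb y -> x = y.
Proof.
case: x y => [x1 x2] [y1 y2]; rewrite /ca /cb /= => ea eb.
have s0 := sqrt3_neq0.
have e2 : x2 = y2.
  have : x2 * 2 / Num.sqrt 3 * (Num.sqrt 3 / 2) = y2 * 2 / Num.sqrt 3 * (Num.sqrt 3 / 2).
    by rewrite eb.
  have e z : z * 2 / Num.sqrt 3 * (Num.sqrt 3 / 2) = z :> R by field; rewrite s0.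
  by rewrite !e.
by move: ea; rewrite e2 => /addIr ->.
Qed.

Lemma ca_qv i : (i < 3)%N -> ca (qv R i) = (i == 1%N)%:R.
Proof.
have s0 := sqrt3_neq0.
by case: i => [|[|[|]]] //= _; rewrite /ca /=; field.
Qed.

Lemma cb_qv i : (i < 3)%N -> cb (qv R i) = (i == 2%N)%:R.
Proof.
have s0 := sqrt3_neq0.
by case: i => [|[|[|]]] //= _; rewrite /cb /=; field.
Qed.

Lemma qv_inj i j : (i < 3)%N -> (j < 3)%N -> qv R i = qv R j -> i = j.
Proof.
move=> i3 j3 e; have := congr1 ca e; have := congr1 cb e.
rewrite !ca_qv // !cb_qv // => /eqP + /eqP; rewrite !eqr_nat.
by move: i3 j3 {e}; case: i => [|[|[|]]] //; case: j => [|[|[|]]].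
Qed.

Variable k : nat.
Hypothesis k2 : (2 <= k)%N.

Let k0 : k%:R != 0 :> R. Proof. by rewrite pnatr_eq0; lia. Qed.

Lemma ca_Sim n x : ca (Sim k n x) = (ca x + (cell k n).1%:R) / k%:R.
Proof.
have s0 := sqrt3_neq0.
rewrite /ca /Sim /bvec /= -/(cell k n); field.
by rewrite s0 k0.
Qed.

Lemma cb_Sim n x : cb (Sim k n x) = (cb x + (cell k n).2%:R) / k%:R.
Proof.
have s0 := sqrt3_neq0.
rewrite /cb /Sim /bvec /= -/(cell k n); field.
by rewrite s0 k0.
Qed.

Lemma ca_Fw w x : ca (Fw k w x) = (ca x + (offset k w).1%:R) / (k ^ size w)%:R.
Proof.
elim: w => [|n w IHw] /=; first by rewrite addr0 divr1.
by rewrite ca_Sim IHw expnS natrD !natrM; field; rewrite k0 natrX expf_neq0.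
Qed.

Lemma cb_Fw w x : cb (Fw k w x) = (cb x + (offset k w).2%:R) / (k ^ size w)%:R.
Proof.
elim: w => [|n w IHw] /=; first by rewrite addr0 divr1.
by rewrite cb_Sim IHw expnS natrD !natrM; field; rewrite k0 natrX expf_neq0.
Qed.

(** Scaling by [k ^ size w] turns corners into integer points, so a coincidence in the plane becomes
    a pair of equations in nat, within reach of [lia]. *)
Lemma Fw_qv_eq w w' i j : size w = size w' -> (i < 3)%N -> (j < 3)%N ->
  Fw k w (qv R i) = Fw k w' (qv R j) <->
  ((i == 1%N) + (offset k w).1 = (j == 1%N) + (offset k w').1)%N /\
  ((i == 2%N) + (offset k w).2 = (j == 2%N) + (offset k w').2)%N.
Proof.
move=> sw i3 j3.
have kw0 : (k ^ size w')%:R != 0 :> R by rewrite natrX expf_neq0.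
split=> [e|[e1 e2]].
  have := congr1 ca e; have := congr1 cb e.
  rewrite !ca_Fw !cb_Fw !ca_qv // !cb_qv // sw -!natrD => /divIf e2 /divIf e1.
  by split; apply/eqP; rewrite -(eqr_nat R); apply/eqP; [exact: e1|exact: e2].
apply: coord_inj.
  by rewrite !ca_Fw !ca_qv // sw -!natrD e1.
by rewrite !cb_Fw !cb_qv // sw -!natrD e2.
Qed.

(** The six differences between two corners of a triangle are distinct lattice vectors. A directed
    edge thus reveals its corner indices, hence the offset of its cell, hence the word. *)
Lemma edge_inj w w' i i' a b : size w = size w' -> valid k w -> valid k w' ->
  (i < 3)%N -> (i' < 3)%N -> (a < 3)%N -> (b < 3)%N -> i != i' ->
  Fw k w (qv R i) = Fw k w' (qv R a) -> Fw k w (qv R i') = Fw k w' (qv R b) ->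
  [/\ w = w', i = a & i' = b].
Proof.
move=> sw vw vw' i3 i'3 a3 b3 ii' /(Fw_qv_eq sw i3 a3)[e1 e2] /(Fw_qv_eq sw i'3 b3)[e3 e4].
have [eia eib] : i = a /\ i' = b.
  move: i3 i'3 a3 b3 ii' e1 e2 e3 e4.
  by case: i => [|[|[|]]] //; case: i' => [|[|[|]]] //; case: a => [|[|[|]]] //;
    case: b => [|[|[|]]] //= *; lia.
subst a b; split=> //; apply: (offset_inj sw vw vw').
by apply: injective_projections; lia.
Qed.

End Coordinates.

(** * Graph energies as sums over cells *)

Section Energy.
Variables (R : realType) (k : nat).
Notation pt := (R * R)%type.
Hypothesis k2 : (2 <= k)%N.

Lemma mem_cellpts w (x : pt) :
  reflect (exists2 i, (i < 3)%N & x = Fw k w (qv R i)) (x \in cellpts R k w).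
Proof.
apply: (iffP idP) => [|[i i3 ->]].
  by rewrite !inE => /or3P[] /eqP ->; [exists 0%N|exists 1%N|exists 2%N].
by move: i3; case: i => [|[|[|]]] // _; rewrite !inE eqxx ?orbT.
Qed.

Lemma mem_Vm m (x : pt) :
  reflect (exists2 w, w \in words k m & exists2 i, (i < 3)%N & x = Fw k w (qv R i))
          (x \in Vm R k m).
Proof.
rewrite mem_undup; apply: (iffP flatten_mapP) => -[w wm].
  by move=> /mem_cellpts ?; exists w.
by move=> ?; exists w => //; exact/mem_cellpts.
Qed.

Lemma Fw_mem_Vm m w i : w \in words k m -> (i < 3)%N -> Fw k w (qv R i) \in Vm R k m.
Proof. by move=> wm i3; apply/mem_Vm; exists w => //; exists i. Qed.

Lemma adjP m (x y : pt) :
  reflect (exists2 w, w \in words k m & exists i j,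
             [/\ (i < 3)%N, (j < 3)%N, i != j, x = Fw k w (qv R i) & y = Fw k w (qv R j)])
          (adj k m x y).
Proof.
apply: (iffP andP) => [[xy /hasP[w wm /andP[/mem_cellpts[i i3 xE] /mem_cellpts[j j3 yE]]]]|].
  exists w => //; exists i, j; split=> //.
  by apply: contraNneq xy => ij; rewrite xE yE ij.
move=> [w wm [i [j [i3 j3 ij -> ->]]]]; split; last first.
  by apply/hasP; exists w => //; apply/andP; split; apply/mem_cellpts; [exists i|exists j].
apply: contraNneq ij => e.
move: (wm); rewrite mem_words => /andP[_ vw].
have [e1 e2] := (Fw_qv_eq R k2 (erefl (size w)) i3 j3).1 e.
by move: i3 j3 e1 e2 {e}; case: i => [|[|[|]]] //; case: j => [|[|[|]]] //= *; lia.
Qed.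

Lemma adj_sym m (x y : pt) : adj k m x y = adj k m y x.
Proof.
rewrite /adj eq_sym; congr (_ && _); apply: eq_has => w; exact: andbC.
Qed.

(** The pairs are ordered, because the double sum in [Em2] meets every edge twice before halving. *)
Definition corner_pairs : seq (nat * nat) :=
  [:: (0, 1); (0, 2); (1, 0); (1, 2); (2, 0); (2, 1)]%N.

Lemma mem_corner_pairs i j :
  ((i, j) \in corner_pairs) = [&& (i < 3)%N, (j < 3)%N & i != j].
Proof. by case: i => [|[|[|i]]]; case: j => [|[|[|j]]]. Qed.

(* Each edge of [Gamma_m] lies in exactly one cell. *)
Lemma big_edges (V : nmodType) m (F : pt -> pt -> V) :
  \sum_(x <- Vm R k m) \sum_(y <- Vm R k m | adj k m x y) F x y =
  \sum_(w <- words k m) \sum_(p <- corner_pairs)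
     F (Fw k w (qv R p.1)) (Fw k w (qv R p.2)).
Proof.
pose E := [seq p <- [seq (x, y) | x <- Vm R k m, y <- Vm R k m] | adj k m p.1 p.2].
pose C := [seq (Fw k w (qv R p.1), Fw k w (qv R p.2)) | w <- words k m, p <- corner_pairs].
transitivity (\sum_(p <- E) F p.1 p.2).
  rewrite big_filter [RHS]big_mkcond big_flatten big_map.
  by apply: eq_bigr => x _; rewrite big_map [LHS]big_mkcond.
transitivity (\sum_(p <- C) F p.1 p.2); last first.
  by rewrite big_flatten big_map; apply: eq_bigr => w _; rewrite big_map.
apply/perm_big/uniq_perm.
- rewrite filter_uniq // allpairs_uniq ?undup_uniq //.
  by move=> [x y] [x' y'] _ _ [-> ->].
- apply: allpairs_uniq => //; first exact: uniq_words.
  move=> _ _ /allpairsP[[w1 [i i']] [wm pP ->]] /allpairsP[[w2 [a b]] [wm' pP' ->]].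
  move: pP pP' wm wm'; rewrite !mem_corner_pairs !mem_words.
  move=> /and3P[i3 i'3 ii'] /and3P[a3 b3 _] /andP[/eqP sw vw] /andP[/eqP sw' vw'] [E1 E2].
  have sww : size w1 = size w2 by rewrite sw.
  by have [-> -> ->] := edge_inj k2 sww vw vw' i3 i'3 a3 b3 ii' E1 E2.
- move=> [x y]; rewrite mem_filter /=; apply/andP/allpairsP.
    move=> [/adjP[w wm [i [j [i3 j3 ij -> ->]]]] _].
    by exists (w, (i, j)); split=> //; rewrite mem_corner_pairs i3 j3.
  move=> [[w [i j]] [/= wm + [-> ->]]]; rewrite mem_corner_pairs => /and3P[i3 j3 ij].
  split; first by apply/adjP; exists w => //; exists i, j.
  by apply/allpairsP; exists (Fw k w (qv R i), Fw k w (qv R j)); split=> //=; exact: Fw_mem_Vm.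
Qed.

(** This is the bilinear form of E_0; composed with [Fw k w] it is, up to the factor r^-m, the share
    of one cell in E_m. *)
Definition corner_form (u v : pt -> R) : R :=
  (u (qv R 0) - u (qv R 1)) * (v (qv R 0) - v (qv R 1)) +
  (u (qv R 0) - u (qv R 2)) * (v (qv R 0) - v (qv R 2)) +
  (u (qv R 1) - u (qv R 2)) * (v (qv R 1) - v (qv R 2)).

Lemma Em2_cells r m (u v : pt -> R) :
  Em2 k r m u v =
  r ^- m * \sum_(w <- words k m) corner_form (u \o Fw k w) (v \o Fw k w).
Proof.
rewrite /Em2 (big_edges m (fun x y => (u x - u y) * (v x - v y))) mulr_sumr.
congr (_ * _); apply: eq_bigr => w _.
by rewrite /corner_pairs !big_cons big_nil /corner_form /=; field.
Qed.

Lemma EmE r m (u : pt -> R) : Em k r m u = Em2 k r m u u.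
Proof. by []. Qed.

Lemma Em_cells r m (u : pt -> R) :
  Em k r m u = r ^- m * \sum_(w <- words k m) corner_form (u \o Fw k w) (u \o Fw k w).
Proof. by rewrite EmE Em2_cells. Qed.

Lemma corner_form_ge0 (u : pt -> R) : 0 <= corner_form u u.
Proof. by rewrite /corner_form -!expr2 !addr_ge0 ?sqr_ge0. Qed.

Lemma Em_0 r (u : pt -> R) : Em k r 0 u = corner_form u u.
Proof. by rewrite Em_cells /= big_cons big_nil expr0 invr1 mul1r addr0. Qed.

(** Discrete self-similarity: the first letter of each word is split off, at the price of one factor
    1/r. *)
Lemma Em2_S r m (u v : pt -> R) :
  Em2 k r m.+1 u v =
  r^-1 * \sum_(n <- iota 0 (dk k)) Em2 k r m (u \o Sim k n) (v \o Sim k n).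
Proof.
rewrite Em2_cells big_wordsS exprS invfM -mulrA mulr_sumr; congr (_ * _).
by apply: eq_bigr => n _; rewrite Em2_cells.
Qed.

Lemma Em_S r m (u : pt -> R) :
  Em k r m.+1 u = r^-1 * \sum_(n <- iota 0 (dk k)) Em k r m (u \o Sim k n).
Proof. exact: Em2_S. Qed.

Lemma Em2_eq r m (u u' v v' : pt -> R) :
  {in Vm R k m, u =1 u'} -> {in Vm R k m, v =1 v'} -> Em2 k r m u v = Em2 k r m u' v'.
Proof.
move=> uu vv; rewrite !Em2_cells; congr (_ * _); apply: eq_big_seq => w wm.
by rewrite /corner_form /comp !uu ?vv ?Fw_mem_Vm.
Qed.

Lemma Em2_bilin r m (a b : R) (u v w : pt -> R) :
  Em2 k r m (fun x => a * u x + b * v x) w = a * Em2 k r m u w + b * Em2 k r m v w.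
Proof.
rewrite !Em2_cells !mulr_sumr -big_split; apply: eq_bigr => s _.
by rewrite /corner_form /=; ring.
Qed.

Lemma Em2_sym r m (u v : pt -> R) : Em2 k r m u v = Em2 k r m v u.
Proof.
rewrite !Em2_cells; congr (_ * _); apply: eq_bigr => s _.
by rewrite /corner_form /=; ring.
Qed.

Lemma Em_add r m (t : R) (u v : pt -> R) :
  Em k r m (fun x => u x + t * v x) =
  Em k r m u + t * 2 * Em2 k r m u v + t ^+ 2 * Em k r m v.
Proof.
rewrite !Em_cells Em2_cells !mulr_sumr -!big_split; apply: eq_bigr => s _.
by rewrite /corner_form /=; ring.
Qed.

Lemma cell_constant (g : pt -> R) r : r != 0 -> Em k r 1 g = 0 ->
  forall n i j, (n < dk k)%N -> (i < 3)%N -> (j < 3)%N ->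
    g (Sim k n (qv R i)) = g (Sim k n (qv R j)).
Proof.
move=> r0 /eqP; rewrite Em_cells mulf_eq0 invr_eq0 expr1 (negbTE r0) /=.
rewrite psumr_eq0 => [/allP H n i j nk i3 j3|w _]; last exact: corner_form_ge0.
have wn : [:: n] \in words k 1 by rewrite mem_words /= nk.
have Fw1 x : Fw k [:: n] x = Sim k n x :> pt by [].
have /eqP := H _ wn; rewrite /corner_form /comp !Fw1 => E.
set a := g (Sim k n (qv R 0)) in E *; set b := g (Sim k n (qv R 1)) in E *.
set c := g (Sim k n (qv R 2)) in E *.
have [ab bc] : a = b /\ b = c.
  move: E (sqr_ge0 (a - b)) (sqr_ge0 (a - c)) (sqr_ge0 (b - c)); rewrite -!expr2 => E ? ? ?.
  by split; apply/eqP; rewrite -subr_eq0 -sqrf_eq0; apply/eqP; lra.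
by move: i3 j3; case: i => [|[|[|]]] //; case: j => [|[|[|]]] // _ _;
  rewrite -?/a -?/b -?/c ?ab ?bc.
Qed.

Lemma Sim_glue n n' i i' : (i < 3)%N -> (i' < 3)%N ->
  ((cell k n).1 + (i == 1) = (cell k n').1 + (i' == 1))%N ->
  ((cell k n).2 + (i == 2) = (cell k n').2 + (i' == 2))%N ->
  Sim k n (qv R i) = Sim k n' (qv R i') :> pt.
Proof.
move=> i3 i'3 e1 e2.
by apply: (Fw_qv_eq R k2 (w := [:: n]) (w' := [:: n']) _ i3 i'3).2 => //=; lia.
Qed.

(* A function constant on the cells of [Gamma_1] and vanishing at [q_0]
   vanishes: walk from the cell [(a, c)] to [(0, 0)]. *)
Lemma Gamma1_connected (g : pt -> R) r : r != 0 -> Em k r 1 g = 0 ->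
  g (qv R 0) = 0 -> {in Vm R k 1, forall x, g x = 0}.
Proof.
move=> r0 /(cell_constant r0) gc g0.
suff H n : (n < dk k)%N -> g (Sim k n (qv R 0)) = 0.
  move=> x /mem_Vm[[|n [|? ?]]]; rewrite mem_words //= andbT => nk [i i3 ->].
  by rewrite /= (gc n i 0%N) // H.
move Es : ((cell k n).1 + (cell k n).2)%N => s.
elim: s n Es => [|s IHs] n Es nk.
  suff -> : Sim k n (qv R 0) = qv R 0 by [].
  apply: coord_inj; rewrite ?ca_Sim ?cb_Sim // ?ca_qv ?cb_qv //= add0r.
    by rewrite (_ : (cell k n).1 = 0)%N ?mul0r //; lia.
  by rewrite (_ : (cell k n).2 = 0)%N ?mul0r //; lia.
have ck := cell_lt nk.
have [a0|a0] := posnP (cell k n).1.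
  have [n' n'k n'E] : exists2 n', (n' < dk k)%N & cell k n' = (0, (cell k n).2.-1)%N.
    by apply: cell_surj; lia.
  rewrite (@Sim_glue n n' 0 2) ?n'E //=; try lia.
  by rewrite (gc n' 2 0)%N // IHs // n'E /=; lia.
have [n' n'k n'E] : exists2 n', (n' < dk k)%N & cell k n' = ((cell k n).1.-1, (cell k n).2)%N.
  by apply: cell_surj; lia.
rewrite (@Sim_glue n n' 0 1) ?n'E //=; try lia.
by rewrite (gc n' 1 0)%N // IHs // n'E /=; lia.
Qed.

End Energy.

(** * Harmonic functions as energy minimisers *)

Section Harmonic.
Variables (R : realType) (k : nat) (r : R).
Notation pt := (R * R)%type.
Hypotheses (k2 : (2 <= k)%N) (hr : is_renorm k r).

Let r_gt0 : 0 < r. Proof. by case: hr. Qed.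

Definition vanishing (g : pt -> R) := forall i, (i < 3)%N -> g (qv R i) = 0.

Lemma Em_0_eq (u v : pt -> R) : (forall i, (i < 3)%N -> u (qv R i) = v (qv R i)) ->
  Em k r 0 u = Em k r 0 v.
Proof. by move=> uv; rewrite !Em_0 // /corner_form !uv. Qed.

Lemma Em_ge0 m (u : pt -> R) : 0 <= Em k r m u.
Proof.
rewrite Em_cells // mulr_ge0 ?invr_ge0 ?exprn_ge0 ?(ltW r_gt0) // sumr_ge0 // => w _.
exact: corner_form_ge0.
Qed.

(** At level 0, [u] itself competes in the minimum that the renormalisation condition equates with
    E_0(u). Splitting off first letters carries the inequality to all levels. *)
Lemma Em_leS m (u : pt -> R) : Em k r m u <= Em k r m.+1 u.
Proof.
elim: m u => [u|m IHm u].
  by have [ut [_ [<- utmin]]] := hr.2 u; exact: utmin.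
by rewrite !(Em_S k2 _ _ u) ler_pM2l ?invr_gt0 // ler_sum.
Qed.

Lemma Em_le m n (u : pt -> R) : (m <= n)%N -> Em k r m u <= Em k r n u.
Proof.
move=> mn; apply: (@homo_leq _ (fun m => Em k r m u) <=%R) => //.
  by move=> ? ? ?; exact: le_trans.
by move=> ?; exact: Em_leS.
Qed.

Definition harmonic (h : pt -> R) := forall m, Em k r m h = Em k r 0 h.

(** Harmonicity of [h] makes the total of E_m - E_0 over all cells vanish; each summand is
    nonnegative by monotonicity, so each vanishes. *)
Lemma harmonic_Sim h n : harmonic h -> (n < dk k)%N -> harmonic (h \o Sim k n).
Proof.
move=> hh nk m; apply/eqP; rewrite -subr_eq0.
have : \sum_(n <- iota 0 (dk k)) (Em k r m (h \o Sim k n) - Em k r 0 (h \o Sim k n)) == 0.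
  have := hh m.+1; rewrite -(hh 1%N) !(Em_S k2 _ _ h) => /mulfI e.
  by rewrite sumrB e ?subrr // invr_eq0 gt_eqF.
rewrite psumr_eq0 => [/allP|i _]; last by rewrite subr_ge0 Em_le.
by apply; rewrite mem_iota.
Qed.

Lemma harmonic_Fw h w : harmonic h -> valid k w -> harmonic (h \o Fw k w).
Proof.
elim: w h => [//|n w IHw] h hh /andP[nk vw].
exact: (IHw (h \o Sim k n) (harmonic_Sim hh nk) vw).
Qed.

Lemma harmonic_cst (c : R) : harmonic (cst c).
Proof.
by move=> m; rewrite !Em_cells // !big1 ?mulr0 // => w _;
  rewrite /corner_form /= !subrr !mulr0 !addr0.
Qed.

Lemma harmonic_energy h w : harmonic h -> valid k w ->
  energy k r (h \o Fw k w) = corner_form (h \o Fw k w) (h \o Fw k w).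
Proof.
move=> hh vw; rewrite /energy; under eq_fun do rewrite (harmonic_Fw hh vw) Em_0 //.
exact: lim_cst.
Qed.

(** First variation: [h + t g] has the corner values of [h], so its E_1 is at least E_0(h) = E_1(h)
    for every real t, and the term linear in t must be zero. *)
Lemma harmonic_orthogonal h g : harmonic h -> vanishing g -> Em2 k r 1 h g = 0.
Proof.
move=> hh g0; set B := Em2 _ _ _ _ _; set C := Em k r 1 g.
have C0 : 0 <= C by exact: Em_ge0.
have ineq t : 0 <= t * 2 * B + t ^+ 2 * C.
  rewrite -(lerD2l (Em k r 1 h)) addr0 addrA -Em_add // (hh 1%N).
  rewrite (@Em_0_eq h (fun x => h x + t * g x)) ?Em_leS // => i i3.
  by rewrite g0 // mulr0 addr0.
(* The minimiser would be t = -B/C; the denominator C + 1 also covers C = 0. *)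
have := ineq (- B / (C + 1)).
have -> : - B / (C + 1) * 2 * B + (- B / (C + 1)) ^+ 2 * C =
    - (B ^+ 2 * ((C + 2) / (C + 1) ^+ 2)) by field; lra.
rewrite oppr_ge0 pmulr_lle0; last by rewrite divr_gt0 ?exprn_gt0 //; lra.
by move=> B0; apply/eqP; rewrite -sqrf_eq0 eq_le B0 sqr_ge0.
Qed.

(** Discrete Green formula: it moves all differences onto [p], so that the energy vanishes when [p]
    has the mean value property off V_0 and [g] vanishes on V_0. *)
Lemma Em2_1_by_parts (p g : pt -> R) :
  Em2 k r 1 p g =
  r^-1 * \sum_(x <- Vm R k 1) g x * \sum_(y <- Vm R k 1 | adj k 1 x y) (p x - p y).
Proof.
rewrite /Em2 expr1; congr (_ * _).
pose S := \sum_(x <- Vm R k 1) \sum_(y <- Vm R k 1 | adj k 1 x y) g x * (p x - p y).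
transitivity (2^-1 * (S + S)); last first.
  rewrite (_ : 2^-1 * _ = S); last by field.
  by apply: eq_bigr => x _; rewrite mulr_sumr.
(* In the second copy of S the roles of x and y are exchanged, which adjacency permits by
   symmetry. *)
congr (_ * _); rewrite {2}/S [X in _ = _ + X](exchange_big_dep predT) //=.
rewrite -big_split; apply: eq_bigr => x _.
rewrite [X in _ = _ + X](eq_bigl (fun y => adj k 1 x y)); last by move=> y; rewrite adj_sym.
by rewrite -big_split; apply: eq_bigr => y _ /=; ring.
Qed.

End Harmonic.

(** * Hitting probabilities of the walk on Gamma_1 *)

Section HittingProbability.
Variables (R : realType) (k l : nat).
Notation pt := (R * R)%type.
Hypotheses (k2 : (2 <= k)%N) (l3 : (l < 3)%N).
Implicit Types s : pt.

Let qvV0 i : (i < 3)%N -> qv R i \in V0 R.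
Proof. by move: i => [|[|[|]]] // _; rewrite !inE eqxx ?orbT. Qed.

Lemma deg1E (x : pt) : (deg1 k x)%:R = \sum_(y <- Vm R k 1) (adj k 1 x y)%:R :> R.
Proof. by rewrite /deg1 -sum1_count natr_sum big_mkcond; apply: eq_bigr => y _; case: ifP. Qed.

Lemma deg1_gt0 (x : pt) : x \in Vm R k 1 -> (0 < deg1 k x)%N.
Proof.
move=> /mem_Vm[w wm [i i3 ->]]; rewrite -has_count; apply/hasP.
have [j j3 ij] : exists2 j, (j < 3)%N & i != j.
  by exists (if i == 0 then 1 else 0)%N; case: i i3 => [|[|[|]]].
exists (Fw k w (qv R j)); first exact: Fw_mem_Vm.
by apply/adjP => //; exists w => //; exists i, j.
Qed.

Lemma hit_at0 (s : pt) : hit_at k l s 0 = (s == qv R l)%:R.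
Proof. by rewrite /hit_at /= big_seq1 /=; case: eqP. Qed.

(** First-step decomposition of the walk. A walk starting in V_0 has hit at time 0 already, hence
    the value 0 at all later times. *)
Lemma hit_atS (s : pt) n : hit_at k l s n.+1 =
  if s \in V0 R then 0
  else \sum_(y <- Vm R k 1) (adj k 1 s y)%:R / (deg1 k s)%:R * hit_at k l y n.
Proof.
rewrite /hit_at; move: (V0 R) => V; rewrite [allseqs _ n.+1]/= big_flatten big_map /=.
case: (s \in V) => /=; first by rewrite big1 // => y _; rewrite big_map big1.
apply: eq_bigr => y _; rewrite big_map mulr_sumr; apply: eq_bigr => p _ /=.
by case: ifP => _ //; rewrite mulr0.
Qed.

Definition hit_before (N : nat) (s : pt) : R := \sum_(0 <= n < N) hit_at k l s n.

Lemma hit_before_V0 N s : s \in V0 R -> hit_before N.+1 s = (s == qv R l)%:R.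
Proof.
move=> sV0; rewrite /hit_before big_nat_recl // hit_at0 big1 ?addr0 // => n _.
by rewrite hit_atS sV0.
Qed.

Lemma hit_beforeS N s : s \notin V0 R -> hit_before N.+1 s =
  \sum_(y <- Vm R k 1) (adj k 1 s y)%:R / (deg1 k s)%:R * hit_before N y.
Proof.
move=> sV0; rewrite /hit_before big_nat_recl // hit_at0.
have -> : (s == qv R l) = false by apply: contraNF sV0 => /eqP ->; exact: qvV0.
rewrite add0r; under eq_bigr do rewrite hit_atS (negbTE sV0).
by rewrite exchange_big; apply: eq_bigr => y _; rewrite mulr_sumr.
Qed.

Lemma hit_at_ge0 s n : 0 <= hit_at k l s n.
Proof.
rewrite /hit_at sumr_ge0 // => p _; case: ifP => // _.
by elim: p s => [//|y p IHp] s /=; rewrite mulr_ge0 ?divr_ge0.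
Qed.

Lemma hit_before_le1 N s : hit_before N s <= 1.
Proof.
elim: N s => [|N IHN] s; first by rewrite /hit_before big_geq.
have [sV0|sV0] := boolP (s \in V0 R).
  by rewrite hit_before_V0 //; case: eqP.
rewrite hit_beforeS //.
apply: (@le_trans _ _ (\sum_(y <- Vm R k 1) (adj k 1 s y)%:R / (deg1 k s)%:R)).
  by apply: ler_sum => y _; rewrite ler_piMr ?divr_ge0.
(* The transition weights sum to 1, or to 0 at a point without neighbours, where division by the
   degree 0 gives 0. *)
rewrite -mulr_suml -deg1E; case: (deg1 k s) => [|n]; first by rewrite mul0r.
by rewrite divff // pnatr_eq0.
Qed.

(** [phit] is a [limn], so its use as a limit requires convergence: the partial sums increase and
    stay below 1. *)
Lemma cvg_hit_before s : hit_before ^~ s @ \oo --> phit k l s.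
Proof.
apply: nondecreasing_is_cvgn.
  apply/nondecreasing_seqP => n.
  by rewrite /hit_before big_nat_recr //= lerDl hit_at_ge0.
by exists 1 => _ [n _ <-]; exact: hit_before_le1.
Qed.

Lemma phit_V0 s : s \in V0 R -> phit k l s = (s == qv R l)%:R.
Proof.
move=> sV0; rewrite -(cvg_lim (@Rhausdorff R) (@cvg_hit_before s)).
apply: cvg_lim => //; rewrite -cvg_shiftS /=.
by under eq_fun do rewrite hit_before_V0 //; exact: cvg_cst.
Qed.

(** The first-step recursion passes to the limit and gives the mean value property off V_0;
    multiplying by the degree puts it in the form needed for summation by parts. *)
Lemma phit_mean s : s \in Vm R k 1 -> s \notin V0 R ->
  \sum_(y <- Vm R k 1 | adj k 1 s y) (phit k l s - phit k l y) = 0.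
Proof.
move=> sV1 sV0.
have d0 : (deg1 k s)%:R != 0 :> R by rewrite pnatr_eq0 -lt0n deg1_gt0.
pose avg := \sum_(y <- Vm R k 1) (adj k 1 s y)%:R / (deg1 k s)%:R * phit k l y.
have to_phit : hit_before N.+1 s @[N --> \oo] --> phit k l s.
  by rewrite (cvg_shiftS (hit_before ^~ s)); exact: cvg_hit_before.
have to_avg : hit_before N.+1 s @[N --> \oo] --> avg.
  have -> : (fun N => hit_before N.+1 s) = (fun N =>
      \sum_(y <- Vm R k 1) (adj k 1 s y)%:R / (deg1 k s)%:R * hit_before N y).
    by apply/funext => N; rewrite hit_beforeS.
  rewrite /avg; elim: (Vm R k 1) => [|y V IHV].
    by rewrite big_nil; under eq_fun do rewrite big_nil; exact: cvg_cst.
  rewrite big_cons; under eq_fun do rewrite big_cons.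
  by apply: cvgD => //; apply: cvgMr; exact: cvg_hit_before.
have avgE : avg = phit k l s := cvg_unique (@Rhausdorff R) to_avg to_phit.
rewrite -avgE big_mkcond (eq_bigr (fun y => avg * (adj k 1 s y)%:R -
    (deg1 k s)%:R * ((adj k 1 s y)%:R / (deg1 k s)%:R * phit k l y))); last first.
  by move=> y _; case: ifP => _ /=; [field|rewrite !mul0r !mulr0 subrr].
by rewrite sumrB -!mulr_sumr -deg1E -/avg; ring.
Qed.

End HittingProbability.

(** * Harmonic extension through hitting probabilities *)

Section Transfer.
Variables (R : realType) (k : nat) (r : R).
Notation pt := (R * R)%type.
Hypotheses (k2 : (2 <= k)%N) (hr : is_renorm k r).

Let r_gt0 : 0 < r. Proof. by case: hr. Qed.

(** Let p be the combination of hitting probabilities with the corner values of [h], and g = h - p.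
    Then E_1(h, g) = 0 by minimality and E_1(p, g) = 0 by parts, so E_1(g) = 0, and connectedness of
    Gamma_1 gives g = 0 on V_1. *)
Lemma harmonic_cell (h : pt -> R) n i : harmonic k r h -> (n < dk k)%N -> (i < 3)%N ->
  h (Sim k n (qv R i)) = \sum_(l < 3) h (qv R l) * pjni R k l n i.
Proof.
move=> hh nk i3.
pose p x := \sum_(l < 3) h (qv R l) * phit k l x.
pose g x := 1 * h x + (-1) * p x.
have qV0 j : (j < 3)%N -> qv R j \in V0 R.
  by move: j => [|[|[|]]] // _; rewrite !inE eqxx ?orbT.
have g0 : vanishing g.
  move=> j j3; rewrite /g /p mul1r mulN1r (bigD1 (Ordinal j3)) //= phit_V0 ?qV0 // eqxx mulr1.
  rewrite big1 ?addr0 ?subrr // => l lj; rewrite phit_V0 ?qV0 //.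
  case: eqP => [/qv_inj|]; last by rewrite mulr0.
  by move=> /(_ j3 (ltn_ord l)) jl; case/eqP: lj; apply: val_inj.
have pg : Em2 k r 1 p g = 0.
  rewrite Em2_1_by_parts // big_seq_cond big1 ?mulr0 // => x /andP[xV1 _].
  have [xV0|xV0] := boolP (x \in V0 R).
    have [j j3 ->] : exists2 j, (j < 3)%N & x = qv R j.
      by move: xV0; rewrite !inE => /or3P[] /eqP ->; [exists 0%N|exists 1%N|exists 2%N].
    by rewrite g0 // mul0r.
  under eq_bigr do rewrite /p -sumrB.
  rewrite exchange_big big1 ?mulr0 // => l _.
  under eq_bigr do rewrite -mulrBr.
  by rewrite -mulr_sumr phit_mean ?mulr0.
have gg : Em k r 1 g = 0.
  by rewrite EmE {1}/g Em2_bilin // pg harmonic_orthogonal // !mulr0 addr0.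
have : g (Sim k n (qv R i)) = 0.
  apply: (Gamma1_connected k2 _ gg) => //; [by rewrite gt_eqF|exact: g0|].
  by apply: (@Fw_mem_Vm _ _ 1%N [:: n]) => //; rewrite mem_words /= nk.
by rewrite /g mul1r mulN1r => /eqP; rewrite subr_eq0 => /eqP.
Qed.

(** The product along [w] of the matrices of hitting probabilities: the weight of the value at q_l
    in the value at F_w(q_i) of any harmonic function. *)
Fixpoint transfer (w : seq nat) (l i : nat) : R :=
  if w is n :: w' then \sum_(l' < 3) pjni R k l n l' * transfer w' l' i
  else (l == i)%:R.

Lemma harmonic_transfer (h : pt -> R) w i : harmonic k r h -> valid k w -> (i < 3)%N ->
  h (Fw k w (qv R i)) = \sum_(l < 3) h (qv R l) * transfer w l i.
Proof.
move=> + + i3; elim: w h => [|n w IHw] h hh.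
  move=> _; rewrite (bigD1 (Ordinal i3)) //= eqxx mulr1 big1 ?addr0 // => l li.
  rewrite (_ : (l == i :> nat) = false) ?mulr0 //.
  by apply: contraNF li => /eqP li; apply/eqP/val_inj.
move=> /andP[nk vw]; rewrite -[LHS]/((h \o Sim k n) (Fw k w (qv R i))).
rewrite IHw //; last exact: harmonic_Sim.
under eq_bigr => l' _ do rewrite /comp harmonic_cell // mulr_suml.
rewrite exchange_big; apply: eq_bigr => l _.
by rewrite mulr_sumr; apply: eq_bigr => l' _; rewrite mulrA.
Qed.

Variable h : nat -> pt -> R.
Hypothesis hh : forall l, (l < 3)%N -> harmonic k r (h l).
Hypothesis hq : forall l j, (l < 3)%N -> (j < 3)%N -> h l (qv R j) = (l == j)%:R.

(** Applied to [h l], the transfer formula shows that [transfer w l i] is the value of [h l] at this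
    corner. Superposition follows without showing that sums of harmonic functions are harmonic. *)
Lemma harmonic_basisE (u : pt -> R) w i : harmonic k r u -> valid k w -> (i < 3)%N ->
  u (Fw k w (qv R i)) = \sum_(l < 3) u (qv R l) * h l (Fw k w (qv R i)).
Proof.
move=> uh vw i3; rewrite harmonic_transfer //; apply: eq_bigr => l _; congr (_ * _).
rewrite (harmonic_transfer (hh (ltn_ord l)) vw i3) (bigD1 l) //= hq // eqxx mul1r.
rewrite big1 ?addr0 // => j jl; rewrite hq // (_ : (l == j :> nat) = false) ?mul0r //.
by apply: contraNF jl => /eqP lj; apply/eqP/val_inj.
Qed.

Lemma harmonic_Sim_corners l j i : (l < 3)%N -> (j < dk k)%N -> (i < 3)%N ->
  h l (Sim k j (qv R i)) = pjni R k l j i.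
Proof.
move=> l3 jk i3; rewrite (harmonic_cell (hh l3) jk i3) (bigD1 (Ordinal l3)) //= hq // eqxx mul1r.
rewrite big1 ?addr0 // => m ml; rewrite hq // (_ : (l == m :> nat) = false) ?mul0r //.
by apply: contraNF ml => /eqP lm; apply/eqP/val_inj.
Qed.

(* Polarising with [h_0 + h_1 + h_2 = 1] expresses the energy of
   [h_l o F_j = sum_i p_i h_i] through the energies of the [h_i] alone. *)
Lemma corner_form_Sim l j w : (l < 3)%N -> (j < dk k)%N -> valid k w ->
  corner_form (h l \o Sim k j \o Fw k w) (h l \o Sim k j \o Fw k w) =
  r * \sum_(i < 3) muM k r j l i * corner_form (h i \o Fw k w) (h i \o Fw k w).
Proof.
move=> l3 jk vw.
have uE i : (i < 3)%N -> (h l \o Sim k j \o Fw k w) (qv R i) =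
    pjni R k l j 0 * h 0 (Fw k w (qv R i)) + pjni R k l j 1 * h 1 (Fw k w (qv R i)) +
    pjni R k l j 2 * h 2 (Fw k w (qv R i)).
  move=> i3; rewrite -[LHS]/((h l \o Sim k j) (Fw k w (qv R i))) harmonic_basisE //.
    by rewrite !big_ord_recl big_ord0 /comp !harmonic_Sim_corners //= addr0 !addrA.
  exact/harmonic_Sim/jk/hh.
have h2E i : (i < 3)%N -> h 2 (Fw k w (qv R i)) =
    1 - h 0 (Fw k w (qv R i)) - h 1 (Fw k w (qv R i)).
  move=> i3; have := harmonic_basisE (harmonic_cst r k2 1) vw i3.
  by rewrite !big_ord_recl big_ord0 /= !mul1r /= => ->; ring.
rewrite !big_ord_recl big_ord0 /= /muM /corner_form !uE // /comp !h2E //.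
by field; rewrite gt_eqF.
Qed.

(** Summation over l collects the entries of M_j into column sums. The factor r will cancel against
    the extra letter of [j :: w] when energies are turned into masses. *)
Lemma kusuoka_cells j w : (j < dk k)%N -> valid k w ->
  \sum_(l < 3) energy k r (h l \o Fw k (j :: w)) =
  r * \sum_(i < 3) Scol k r j i * energy k r (h i \o Fw k w).
Proof.
move=> jk vw.
have vjw : valid k (j :: w) by rewrite /= jk.
under eq_bigr => l _ do rewrite (harmonic_energy k2 hr (hh (ltn_ord l)) vjw)
  -[h l \o Fw k (j :: w)]/(h l \o Sim k j \o Fw k w) corner_form_Sim //.
rewrite -mulr_sumr exchange_big; congr (_ * _); apply: eq_bigr => i _.
by rewrite (harmonic_energy k2 hr (hh (ltn_ord i)) vw) -mulr_suml.
Qed.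

End Transfer.

(** * Position of K in the plane *)

Lemma continuous_pair (T U V : topologicalType) (f : T -> U) (g : T -> V) :
  continuous f -> continuous g -> continuous (fun x => (f x, g x)).
Proof. by move=> cf cg x; exact: (cvg_pair (cf x) (cg x)). Qed.

Section Geometry.
Variables (R : realType) (k : nat) (K : set (R * R)).
Notation pt := (R * R)%type.
Hypotheses (k2 : (2 <= k)%N) (KSG : is_SG k K).

Let k0 : 0 < k%:R :> R. Proof. by rewrite ltr0n; lia. Qed.
Let k1 : 1 < k%:R :> R. Proof. by rewrite ltr1n. Qed.

Let compK : compact K. Proof. by case: KSG. Qed.
Let K0 : K !=set0. Proof. by case: KSG => _ []. Qed.

Lemma SG_cover x : K x -> exists n y, [/\ (n < dk k)%N, K y & x = Sim k n y].
Proof.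
case: KSG => _ [_ KE]; rewrite {1}KE => -[n /= nk [y Ky <-]].
by exists n, y.
Qed.

Lemma SG_Sim n x : (n < dk k)%N -> K x -> K (Sim k n x).
Proof.
move=> nk Kx; case: KSG => _ [_ ->]; by exists n.
Qed.

Lemma SG_Fw w x : valid k w -> K x -> K (Fw k w x).
Proof.
move=> + Kx; elim: w => [//|n w IHw] /andP[nk vw].
exact: (SG_Sim nk (IHw vw)).
Qed.

Lemma SG_cover_words m x : K x ->
  exists w y, [/\ w \in words k m, K y & x = Fw k w y].
Proof.
elim: m x => [|m IHm] x Kx; first by exists [::], x.
have [n [y [nk Ky ->]]] := SG_cover Kx; have [w [z [wm Kz ->]]] := IHm y Ky.
exists (n :: w), z; split=> //; move: wm; rewrite !mem_words /= eqSS.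
by move=> /andP[-> ->]; rewrite nk.
Qed.

Lemma continuous_ca : continuous (@ca R : pt -> R).
Proof.
move=> x; apply: cvgB; first exact: cvg_fst.
by apply: cvgMl; exact: cvg_snd.
Qed.

Lemma continuous_cb : continuous (@cb R : pt -> R).
Proof. by move=> x; apply: cvgMl; apply: cvgMl; exact: cvg_snd. Qed.

Lemma continuous_Sim n : continuous (Sim k n : pt -> pt).
Proof.
apply: continuous_pair => x; (apply: cvgD; last exact: cvg_cst); apply: cvgMl.
  exact: cvg_fst.
exact: cvg_snd.
Qed.

Lemma continuous_Fw w : continuous (Fw k w : pt -> pt).
Proof.
elim: w => [|n w IHw] x; first exact: cvg_id.
by apply: continuous_comp; [exact: IHw|exact: continuous_Sim].
Qed.

(** Maximum principle: a maximum point z of [g] on K is F_n(y) with y in K, so k g(z) <= g(y) + (k -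
    1) c <= g(z) + (k - 1) c, and k > 1 gives g(z) <= c. *)
Lemma SG_le (g : pt -> R) (c : R) : continuous g ->
  (forall n y, (n < dk k)%N -> g (Sim k n y) <= (g y + (k%:R - 1) * c) / k%:R) ->
  forall x, K x -> g x <= c.
Proof.
move=> cg gS x Kx.
have [z /set_mem Kz zmax] := compact_EVT_max K0 compK (continuous_subspaceT cg).
apply: (le_trans (zmax x (mem_set Kx))).
have [n [y [nk Ky zE]]] := SG_cover Kz.
have := gS n y nk; rewrite -zE ler_pdivlMr // => gz.
have gy := zmax y (mem_set Ky).
by have := k1; nra.
Qed.

Lemma SG_triangle x : K x -> [/\ 0 <= ca x, 0 <= cb x & ca x + cb x <= 1].
Proof.
move=> Kx; split.
- rewrite -oppr_le0; apply: (SG_le _ _ Kx (g := fun x => - ca x)).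
    by move=> z; apply: cvgN; exact: continuous_ca.
  move=> n y nk; rewrite mulr0 addr0 ca_Sim // -mulNr ler_pM2r ?invr_gt0 //.
  by rewrite opprD gerDl oppr_le0.
- rewrite -oppr_le0; apply: (SG_le _ _ Kx (g := fun x => - cb x)).
    by move=> z; apply: cvgN; exact: continuous_cb.
  move=> n y nk; rewrite mulr0 addr0 cb_Sim // -mulNr ler_pM2r ?invr_gt0 //.
  by rewrite opprD gerDl oppr_le0.
- apply: (SG_le _ _ Kx (g := fun x => ca x + cb x)).
    by move=> z; apply: cvgD; [exact: continuous_ca|exact: continuous_cb].
  move=> n y nk; rewrite mulr1 ca_Sim // cb_Sim // -mulrDl ler_pM2r ?invr_gt0 //.
  have := cell_lt nk; rewrite -(ltr_nat R) natrD => _.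
  have : ((cell k n).1 + (cell k n).2).+1%:R <= k%:R :> R by rewrite ler_nat cell_lt.
  by rewrite -natr1 natrD; lra.
Qed.

(** The maps in question belong to the extreme cells (0, 0), (k - 1, 0) and (0, k - 1). *)
Lemma corner_fixed i : (i < 3)%N -> exists2 n, (n < dk k)%N & Sim k n (qv R i) = qv R i.
Proof.
move=> i3.
have [n nk nE] : exists2 n, (n < dk k)%N &
    cell k n = ((i == 1) * k.-1, (i == 2) * k.-1)%N.
  by apply: cell_surj; case: i i3 => [|[|[|]]] //= _; lia.
exists n => //.
have kE : k%:R = k.-1%:R + 1 :> R by rewrite natr1; congr (_%:R); lia.
have h (b : bool) : (b%:R + (b * k.-1)%:R) / k%:R = b%:R :> R.
  by rewrite natrM -{1}[b%:R]mulr1 -mulrDr addrC -kE mulfK // gt_eqF.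
apply: coord_inj; first by rewrite ca_Sim // ca_qv // nE /= h.
by rewrite cb_Sim // cb_qv // nE /= h.
Qed.

(** The map fixing q_i divides the distance D to q_i by k and preserves K, so the minimum of D over
    the compact K can only be 0. *)
Lemma SG_corner i : (i < 3)%N -> K (qv R i).
Proof.
move=> i3; set q := qv R i.
have [n nk] := corner_fixed i3; rewrite -/q => nq.
pose D x := `|ca x - ca q| + `|cb x - cb q|.
have cD : continuous (D : pt -> R).
  by move=> x; apply: cvgD; apply: cvg_norm; apply: cvgB; try exact: cvg_cst;
    [exact: continuous_ca|exact: continuous_cb].
have [z /set_mem Kz zmin] := compact_EVT_min K0 compK (continuous_subspaceT cD).
have DS : D (Sim k n z) = D z / k%:R.
  have aE : ca (Sim k n z) - ca q = (ca z - ca q) / k%:R by rewrite -{1}nq !ca_Sim //; ring.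
  have bE : cb (Sim k n z) - cb q = (cb z - cb q) / k%:R by rewrite -{1}nq !cb_Sim //; ring.
  by rewrite /D aE bE !normrM -mulrDl [`|k%:R^-1|]gtr0_norm ?invr_gt0.
have := zmin (Sim k n z) (mem_set (SG_Sim nk Kz)); rewrite DS ler_pdivlMr // => Dz.
have D0 : D z = 0.
  have : 0 <= D z by rewrite addr_ge0.
  by have := k1; nra.
move/eqP: D0; rewrite paddr_eq0 // !normr_eq0 !subr_eq0 => /andP[/eqP e1 /eqP e2].
by rewrite -(coord_inj e1 e2).
Qed.

Lemma SG_Vm m x : x \in Vm R k m -> K x.
Proof.
move=> /mem_Vm[w]; rewrite mem_words => /andP[_ vw] [i i3 ->].
exact/SG_Fw/SG_corner.
Qed.

(* Cells meet only at corners: the lattice offset between two distinct cells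
   is nonzero, which forces the barycentric coordinates to be 0 or 1. *)
Lemma SG_cells_meet n j x y : (n < dk k)%N -> (j < dk k)%N -> n != j -> K x -> K y ->
  Sim k j x = Sim k n y -> exists2 i, (i < 3)%N & x = qv R i.
Proof.
move=> nk jk nj Kx Ky e.
have [ax bx abx] := SG_triangle Kx; have [ay by_ aby] := SG_triangle Ky.
have := congr1 (@ca R) e; have := congr1 (@cb R) e.
rewrite !ca_Sim // !cb_Sim // => /divIf eb /divIf ea.
have {}ea := ea (lt0r_neq0 k0); have {e}eb := eb (lt0r_neq0 k0).
have q0 : ca x = 0 -> cb x = 0 -> exists2 i, (i < 3)%N & x = qv R i.
  by move=> xa xb; exists 0%N => //; apply: coord_inj; rewrite ?ca_qv ?cb_qv.
have q1 : ca x = 1 -> cb x = 0 -> exists2 i, (i < 3)%N & x = qv R i.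
  by move=> xa xb; exists 1%N => //; apply: coord_inj; rewrite ?ca_qv ?cb_qv.
have q2 : ca x = 0 -> cb x = 1 -> exists2 i, (i < 3)%N & x = qv R i.
  by move=> xa xb; exists 2%N => //; apply: coord_inj; rewrite ?ca_qv ?cb_qv.
have lt_nat (a b : nat) : (a < b)%N -> a%:R + 1 <= b%:R :> R by rewrite natr1 ler_nat.
case: (ltngtP (cell k j).1 (cell k n).1) => c1.
- have c := lt_nat _ _ c1; apply: q1; lra.
- have c := lt_nat _ _ c1.
  have bxE : cb x + (cell k j).2%:R = (cell k n).2%:R by lra.
  case: (ltngtP (cell k j).2 (cell k n).2) => c2.
  + have c' := lt_nat _ _ c2; apply: q2; lra.
  + by exfalso; have c' := lt_nat _ _ c2; lra.
  + by apply: q0; [lra|move: bxE; rewrite c2; lra].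
- rewrite c1 in ea.
  case: (ltngtP (cell k j).2 (cell k n).2) => c2.
  + have c' := lt_nat _ _ c2; apply: q2; lra.
  + have c' := lt_nat _ _ c2; apply: q0; lra.
  + by case/eqP: nj; apply: (cell_inj nk jk); exact: injective_projections.
Qed.

End Geometry.

(** * Extension by zero from a cell *)

Section Glue.
Variables (R : realType) (k : nat) (K : set (R * R)) (r : R).
Notation pt := (R * R)%type.
Hypotheses (k2 : (2 <= k)%N) (KSG : is_SG k K) (hr : is_renorm k r).

Let k0 : k%:R != 0 :> R. Proof. by rewrite pnatr_eq0; lia. Qed.

Definition Sim_inv n (x : pt) : pt :=
  ((x.1 - (bvec R k n).1) * k%:R, (x.2 - (bvec R k n).2) * k%:R).

Lemma SimK n : cancel (Sim k n) (Sim_inv n).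
Proof. by move=> [x1 x2]; rewrite /Sim_inv /Sim /= !addrK !divfK. Qed.

Lemma continuous_Sim_inv n : continuous (Sim_inv n).
Proof.
apply: continuous_pair => x; apply: cvgMl; (apply: cvgB; last exact: cvg_cst).
  exact: cvg_fst.
exact: cvg_snd.
Qed.

Definition glue j (v : pt -> R) (x : pt) : R :=
  if Sim_inv j x \in K then v (Sim_inv j x) else 0.

Lemma glue_Sim j v x : K x -> glue j v (Sim k j x) = v x.
Proof. by move=> Kx; rewrite /glue SimK mem_set. Qed.

Lemma glue_Sim_neq j n v x : vanishing v -> (j < dk k)%N -> (n < dk k)%N -> n != j ->
  K x -> glue j v (Sim k n x) = 0.
Proof.
move=> v0 jk nk nj Kx; rewrite /glue; case: ifPn => // /set_mem Ky.
have e : Sim k j (Sim_inv j (Sim k n x)) = Sim k n x.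
  by rewrite {1}/Sim /Sim_inv /= !mulfK // !subrK.
by have [i i3 ->] := SG_cells_meet k2 KSG nk jk nj Ky Kx e; rewrite v0.
Qed.

Lemma glue_corner j v : vanishing v -> (j < dk k)%N -> vanishing (glue j v).
Proof.
move=> v0 jk i i3; have [n nk nq] := @corner_fixed R k k2 i i3.
have Kq := SG_corner k2 KSG i3.
have [nj|nj] := eqVneq n j; first by rewrite -nq nj glue_Sim // v0.
by rewrite -nq glue_Sim_neq.
Qed.

(** Pasting along two closed sets, the cell of j and the finite union of all other cells: on the
    first the function is v o F_j^-1, on the second it is 0. *)
Lemma glue_continuous j v : vanishing v -> (j < dk k)%N ->
  {within K, continuous v} -> {within K, continuous (glue j v)}.
Proof.
move=> v0 jk cv.
pose A := Sim k j @` K.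
pose B := \bigcup_(n in [set n | (n < dk k)%N /\ n != j]) (Sim k n @` K).
have closedS n : closed (Sim k n @` K).
  apply: (compact_closed (@norm_hausdorff _ _)); apply: continuous_compact; last by case: KSG.
  exact/continuous_subspaceT/continuous_Sim.
have KAB : K = A `|` B.
  apply/seteqP; split=> [x /(SG_cover KSG)[n [y [nk Ky ->]]]|x [[y Ky <-]|[n [nk _] [y Ky <-]]]].
  - have [->|nj] := eqVneq n j; [left|right]; first by exists y.
    by exists n; [split|exists y].
  - exact: (SG_Sim KSG).
  - exact: (SG_Sim KSG).
rewrite KAB; apply: withinU_continuous => //.
- exact: closedS.
- apply: closed_bigcup => //.
  by apply: (@sub_finite_set _ _ `I_(dk k)); [move=> n /= []|exact: finite_II].
- apply/subspace_continuousP => x [y Ky yx].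
  have gA z : A z -> glue j v z = v (Sim_inv j z) by move=> [t Kt <-]; rewrite glue_Sim // SimK.
  rewrite /from_subspace gA; last by exists y.
  have vy : v @ within K (nbhs (Sim_inv j x)) --> v (Sim_inv j x).
    by rewrite -yx SimK; move/subspace_continuousP : cv; exact.
  have iA : Sim_inv j @ within A (nbhs x) --> within K (nbhs (Sim_inv j x)).
    move=> P /= wP; have := continuous_Sim_inv wP.
    rewrite /= /within /= !nbhs_simpl /=.
    by apply: filterS => z /= + [t Kt tz]; rewrite -tz SimK; exact.
  apply: (cvg_trans _ (cvg_comp _ _ iA vy)); apply: near_eq_cvg.
  by near=> z; rewrite gA //; near: z; exact: withinT.
- apply: (@subspace_eq_continuous _ B _ (cst 0)); last exact: cst_continuous.
  move=> x /set_mem[n [nk nj] [y Ky <-]]; rewrite /from_subspace glue_Sim_neq //.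
Unshelve. all: by end_near. Qed.

Lemma Em2_glue m j u v : vanishing v -> (j < dk k)%N ->
  Em2 k r m.+1 u (glue j v) = r^-1 * Em2 k r m (u \o Sim k j) v.
Proof.
move=> v0 jk; rewrite Em2_S //; congr (_ * _).
rewrite (bigD1_seq j) ?mem_iota ?iota_uniq //= [X in _ + X]big_seq_cond big1 ?addr0 => [|n].
  by apply: Em2_eq => // x /(SG_Vm k2 KSG) Kx; rewrite /= glue_Sim.
rewrite mem_iota /= => /andP[nk nj].
(* The zero function is written as a linear combination so that [Em2_bilin] applies. *)
rewrite (@Em2_eq _ _ k2 _ _ _ (u \o Sim k n) _ (fun x => 0 * v x + 0 * v x)) //.
  by rewrite Em2_sym // Em2_bilin // !mul0r addr0.
by move=> x /(SG_Vm k2 KSG) Kx; rewrite /= glue_Sim_neq // !mul0r addr0.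
Qed.

Lemma Em_glue m j v : vanishing v -> (j < dk k)%N ->
  Em k r m.+1 (glue j v) = r^-1 * Em k r m v.
Proof.
move=> v0 jk; rewrite EmE Em2_glue // EmE; congr (_ * _).
by apply: Em2_eq => // x /(SG_Vm k2 KSG) Kx; rewrite /= glue_Sim.
Qed.

Lemma glue_domE0 j v : (j < dk k)%N -> in_domE0 k r K v -> in_domE0 k r K (glue j v).
Proof.
move=> jk [[cv /cvg_ex[l vl]] v0]; split; last exact: glue_corner.
split; first exact: glue_continuous.
apply/cvg_ex; exists (r^-1 * l).
rewrite -cvg_shiftS /=; under eq_fun do rewrite Em_glue //.
exact: cvgMr.
Qed.

(** [in_domE] speaks only of quadratic energies, so the mixed one is polarised. E_m(u + v) increases
    with m and is bounded by 2 E(u) + 2 E(v). *)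
Lemma is_cvg_Em2 u v : cvgn (fun m => Em k r m u) -> cvgn (fun m => Em k r m v) ->
  cvgn (fun m => Em2 k r m u v).
Proof.
move=> cu cv.
have -> : (fun m => Em2 k r m u v) = (fun m =>
    2^-1 * (Em k r m (fun x => u x + 1 * v x) - Em k r m u - Em k r m v)).
  by apply/funext => m; rewrite Em_add //; field.
apply: is_cvgMr; apply: is_cvgB => //; apply: is_cvgB => //.
have nd w : nondecreasing_seq (fun m => Em k r m w) by move=> m n; exact: Em_le.
apply: nondecreasing_is_cvgn; first exact: nd.
exists (2 * limn (fun m => Em k r m u) + 2 * limn (fun m => Em k r m v)).
move=> _ [m _ <-].
have := nondecreasing_cvgn_le (nd u) cu m; have := nondecreasing_cvgn_le (nd v) cv m.
(* Nonnegativity of E_m(u - v) bounds the cross term from above. *)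
have := Em_ge0 k2 hr m (fun x => u x + (-1) * v x).
rewrite !Em_add //; lra.
Qed.

Lemma energy2_glue j u v : (j < dk k)%N -> in_domE k r K u -> in_domE0 k r K v ->
  energy2 k r (u \o Sim k j) v = r * energy2 k r u (glue j v).
Proof.
move=> jk [_ cu] dv; have [[_ cg] _] := glue_domE0 jk dv; case: dv => _ v0.
have r0 : r != 0 by case: hr => r0 _; rewrite gt_eqF.
apply: cvg_lim => //.
have -> : (fun m => Em2 k r m (u \o Sim k j) v) = (fun m => r * Em2 k r m.+1 u (glue j v)).
  by apply/funext => m; rewrite Em2_glue // mulVKf.
apply: cvgMr; rewrite (cvg_shiftS (fun m => Em2 k r m u (glue j v))).
exact: is_cvg_Em2.
Qed.

End Glue.

(** * Integrals over covers with null overlaps *)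

Section AlmostPartition.
Context d (T : measurableType d) (R : realType) (mu : {measure set T -> \bar R}).
Variables (D : set T) (mD : measurable D) (muD : (mu D < +oo)%E).

Lemma Rintegral_sum (I : Type) (s : seq I) (f : I -> T -> R) :
  (forall i, mu.-integrable D (EFin \o f i)) ->
  \int[mu]_(x in D) (\sum_(i <- s) f i x) = \sum_(i <- s) \int[mu]_(x in D) f i x.
Proof.
move=> fi; elim: s => [|i s IHs].
  by under eq_Rintegral do rewrite big_nil; rewrite big_nil Rintegral_cst // mul0r.
under eq_Rintegral do rewrite big_cons.
rewrite big_cons RintegralD // ?IHs //.
have -> : EFin \o (fun x => \sum_(j <- s) f j x) = (fun x => \sum_(j <- s) (f j x)%:E)%E.
  by apply/funext => x; rewrite /= sumEFin.
by apply: (integrable_sum mD) => j _; exact: fi.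
Qed.

Variables (I : eqType) (s : seq I) (C : I -> set T).
Hypotheses (mC : forall i, measurable (C i)).
Hypothesis DC : forall x, D x -> exists2 i, i \in s & C i x.
Hypothesis muDC : mu D = (\sum_(i <- s) mu (D `&` C i))%E.

Let N (x : T) : R := \sum_(i <- s) \1_(C i) x.

Let indic_bounded i : [bounded (\1_(C i) : T -> R) x | x in D].
Proof.
exists 1; split; first exact: num_real.
move=> a a1 x _; rewrite /= indicE ger0_norm ?ler0n //.
by rewrite (le_trans _ (ltW a1)) // lern1; case: (x \in C i).
Qed.

Let indic_integrable i : mu.-integrable D (EFin \o (\1_(C i) : T -> R)).
Proof. by apply: measurable_bounded_integrable => //; exact: indic_bounded. Qed.

(* The multiplicity [N] of the cover is at least 1 and has the integral of 1. *)
Let N_ae1 : ae_eq mu D (fun x => (N x - 1)%:E) (cst 0%E).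
Proof.
have mN : measurable_fun D N by apply: measurable_sum => i; exact: measurable_indic.
apply/ae_eq_integral_abs => //; first by apply/measurable_EFinP; exact: measurable_funB.
have N1 x : D x -> 1 <= N x.
  move=> Dx; have [i si Cx] := DC Dx; rewrite /N (perm_big _ (perm_to_rem si)) big_cons /=.
  by rewrite indicE mem_set //= lerDl sumr_ge0.
have iN : mu.-integrable D (EFin \o N).
  have -> : EFin \o N = (fun x => \sum_(i <- s) (\1_(C i) x)%:E)%E.
    by apply/funext => x; rewrite /N /= sumEFin.
  by apply: (integrable_sum mD) => i _; exact: indic_integrable.
have i1 : mu.-integrable D (EFin \o cst (1 : R)).
  apply: measurable_bounded_integrable => //; exists 1; split; first exact: num_real.
  by move=> a a1 x _; rewrite /= normr1 ltW.
rewrite (eq_integral (fun x => (N x)%:E - (1 : R)%:E)%E); last first.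
  by move=> x /set_mem Dx /=; rewrite ger0_norm // subr_ge0 N1.
rewrite (integralB_EFin mD iN i1) /=.
have -> : (\int[mu]_(x in D) (N x)%:E = mu D)%E.
  under eq_integral do rewrite /N -sumEFin.
  rewrite integral_sum // muDC; apply: eq_bigr => i _.
  by rewrite integral_indic // setIC.
by rewrite integral_cst // mul1e subee // ge0_fin_numE.
Qed.

(** Since N = 1 almost everywhere, [g] may be replaced by g N, whose integral splits along the
    indicators. *)
Lemma Rintegral_almost_partition (g : T -> R) : mu.-integrable D (EFin \o g) ->
  \int[mu]_(x in D) g x = \sum_(i <- s) \int[mu]_(x in D `&` C i) g x.
Proof.
move=> ig.
have ii i : mu.-integrable D (EFin \o (fun x => g x * \1_(C i) x)).
  have -> : EFin \o (fun x => g x * \1_(C i) x) = ((EFin \o g) \* (EFin \o \1_(C i)))%E.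
    by apply/funext => x; rewrite /= EFinM.
  by apply: integrableMl => //; exact: measurable_indic.
transitivity (\int[mu]_(x in D) (\sum_(i <- s) g x * \1_(C i) x)).
  rewrite /Rintegral; congr fine; apply: ae_eq_integral => //.
  - exact: measurable_int ig.
  - apply/measurable_EFinP; apply: measurable_sum => i.
    by apply/measurable_EFinP; exact: measurable_int (ii i).
  case: N_ae1 => A [mA A0 NA]; exists A; split => // x nx; apply: NA => /= N1; apply: nx => Dx.
  have [Nx] := N1 Dx; rewrite -mulr_sumr -/(N x).
  by move/eqP: Nx; rewrite subr_eq0 => /eqP ->; rewrite mulr1.
rewrite Rintegral_sum //; apply: eq_bigr => i _.
by rewrite Rintegral_mkcondr patch_indic.
Qed.

(** The weights are integrals of [rho], not masses, so only [phi] has to be nearly constant on the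
    pieces; [rho] may be any integrable function, of either sign. *)
Lemma Riemann_sum_dist (e : R) (phi rho : T -> R) (c : I -> R) : 0 <= e ->
  mu.-integrable D (EFin \o rho) ->
  mu.-integrable D (EFin \o (fun x => phi x * rho x)) ->
  (forall i x, i \in s -> D x -> C i x -> `|phi x - c i| <= e) ->
  `| \int[mu]_(x in D) (phi x * rho x) - \sum_(i <- s) c i * \int[mu]_(x in D `&` C i) rho x|
    <= e * \int[mu]_(x in D) `|rho x|.
Proof.
move=> e0 ir ipr pc.
have iabs : mu.-integrable D (EFin \o (fun x => `|rho x|)) by exact: integrable_norm.
have mDC i : measurable (D `&` C i) by exact: measurableI.
have sub i (g : T -> R) : mu.-integrable D (EFin \o g) -> mu.-integrable (D `&` C i) (EFin \o g).
  by apply: integrableS => //; exact: subIsetl.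
rewrite (Rintegral_almost_partition ipr) (Rintegral_almost_partition iabs) mulr_sumr -sumrB.
apply: le_trans (ler_norm_sum _ _ _) _.
rewrite big_seq [leRHS]big_seq; apply: ler_sum => i si.
have icr : mu.-integrable (D `&` C i) (EFin \o (fun x => c i * rho x)).
  by have := integrableZl (mDC i) (c i) (sub i _ ir).
rewrite -RintegralZl //; last exact: sub.
rewrite -RintegralB //; last exact: sub.
apply: le_trans (le_normr_Rintegral _ _) _ => //.
  by have := integrableB (mDC i) (sub i _ ipr) icr.
rewrite -RintegralZl //; last exact: sub.
apply: le_Rintegral => //.
- by apply: integrable_norm; have := integrableB (mDC i) (sub i _ ipr) icr.
- by have := integrableZl (mDC i) e (sub i _ iabs).
- by move=> x [Dx Cx]; rewrite -mulrBl normrM ler_wpM2r // pc.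
Qed.

End AlmostPartition.

(** * Borel sets of the plane *)

Section PlaneMeasurable.
Variable R : realType.
Notation pt := (R * R)%type.

(** Measurability here refers to the product sigma-algebra, so an open set is written as the
    countable union of the rational boxes inside it. *)
Lemma open_measurable_plane (A : set pt) : open A -> measurable A.
Proof.
move=> oA.
pose box (q : (rat * rat) * (rat * rat)) : set pt :=
  `]ratr q.1.1, ratr q.1.2[ `*` `]ratr q.2.1, ratr q.2.2[.
have -> : A = \bigcup_q (if `[< box q `<=` A >] then box q else set0).
  apply/seteqP; split=> [x Ax|x [q _]]; last by case: asboolP => // qA /qA.
  have /nbhs_ballP[e /= e0 eA] : nbhs x A by exact: open_nbhs_nbhs.
  have rat_near (a b : R) : a < b -> exists q, a < ratr q < b.
    by move=> /rat_in_itvoo[q]; rewrite in_itv; exists q.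
  have lt_sub (a : R) : a - e < a by rewrite ltrBlDr ltrDl.
  have lt_add (a : R) : a < a + e by rewrite ltrDl.
  have [p1 /andP[p1l p1r]] := rat_near _ _ (lt_sub x.1).
  have [p2 /andP[p2l p2r]] := rat_near _ _ (lt_add x.1).
  have [q1 /andP[q1l q1r]] := rat_near _ _ (lt_sub x.2).
  have [q2 /andP[q2l q2r]] := rat_near _ _ (lt_add x.2).
  exists ((p1, p2), (q1, q2)) => //; case: asboolP => [_|[]].
    by split; rewrite /= in_itv /=; apply/andP.
  move=> y [/= + +]; rewrite !in_itv /= => /andP[y1 y2] /andP[y3 y4].
  by apply: eA; split; rewrite /ball /= ltr_norml; lra.
apply: countable_bigcupT_measurable => // q; case: ifP => // _.
by apply: measurableX; exact: measurable_itv.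
Qed.

Lemma compact_measurable_plane (A : set pt) : compact A -> measurable A.
Proof.
move=> /(compact_closed (@norm_hausdorff _ _)) cA; rewrite -[A]setCK; apply: measurableC.
by apply: open_measurable_plane; exact: closed_openC.
Qed.

Lemma continuous_measurable_plane (A : set pt) (f : pt -> R) : compact A ->
  {within A, continuous f} -> measurable_fun A f.
Proof.
move=> cA /continuousP cf.
apply: (measurability _ (RGenOpens.measurableE R)) => _ [_ [a [b ->] <-]].
have /open_subspaceP[V oV VE] := cf _ (@interval_open R (BRight a) (BLeft b) isT isT).
rewrite setIC -VE; apply: measurableI; first exact: open_measurable_plane.
exact: compact_measurable_plane.
Qed.

End PlaneMeasurable.

(** * Riemann sums over cells *)

Section SelfSimilarIntegral.
Variables (R : realType) (k : nat) (K : set (R * R)).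
Notation pt := (R * R)%type.
Hypotheses (k2 : (2 <= k)%N) (KSG : is_SG k K).

Let k0 : k%:R != 0 :> R. Proof. by rewrite pnatr_eq0; lia. Qed.
Let compK : compact K. Proof. by case: KSG. Qed.

Definition SGcell (w : seq nat) : set pt := Fw k w @` K.

Lemma SGcell_nil : SGcell [::] = K.
Proof. by apply/seteqP; split=> [x [y Ky <-]|x Kx] //; exists x. Qed.

Lemma SGcell_sub w : valid k w -> SGcell w `<=` K.
Proof. by move=> vw x [y Ky <-]; exact: SG_Fw. Qed.

Lemma measurable_SGcell w : measurable (SGcell w).
Proof.
apply: compact_measurable_plane; apply: continuous_compact => //.
by apply: continuous_subspaceT; exact: continuous_Fw.
Qed.

Lemma Fw_diff w (x y : pt) :
  (Fw k w x).1 - (Fw k w y).1 = (x.1 - y.1) * k%:R^-1 ^+ size w /\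
  (Fw k w x).2 - (Fw k w y).2 = (x.2 - y.2) * k%:R^-1 ^+ size w.
Proof.
elim: w => [|n w [IH1 IH2]]; first by rewrite !expr0 !mulr1.
have S1 (a b : pt) : (Sim k n a).1 - (Sim k n b).1 = (a.1 - b.1) / k%:R.
  by rewrite /Sim /=; ring.
have S2 (a b : pt) : (Sim k n a).2 - (Sim k n b).2 = (a.2 - b.2) / k%:R.
  by rewrite /Sim /=; ring.
by rewrite [Fw _ _ x]/= [Fw _ _ y]/= S1 S2 IH1 IH2 /= exprSr !mulrA.
Qed.

(** Uniform continuity on the compact K, combined with the fact that F_w shrinks coordinate
    differences, at most 2M on K, by k^-m. *)
Lemma continuous_small_oscillation (phi : pt -> R) (e : R) : 0 < e ->
  {within K, continuous phi} ->
  \forall m \near \oo, forall w x y, w \in words k m -> K x -> K y ->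
    `|phi (Fw k w x) - phi (Fw k w y)| <= e.
Proof.
move=> e0 /subspace_continuousP cphi.
have K0 : K !=set0 by case: KSG => _ [].
have cD : continuous (fun x : pt => `|x.1| + `|x.2|).
  by move=> x; apply: cvgD; apply: cvg_norm; [exact: cvg_fst|exact: cvg_snd].
have [c _ cmax] := compact_EVT_max K0 compK (continuous_subspaceT cD).
pose M := `|c.1| + `|c.2|.
have diam x y : K x -> K y -> `|x.1 - y.1| <= 2 * M /\ `|x.2 - y.2| <= 2 * M.
  move=> /mem_set/cmax xM /mem_set/cmax yM; rewrite /M in xM yM *.
  have := ler_normB x.1 y.1; have := ler_normB x.2 y.2.
  have := normr_ge0 x.1; have := normr_ge0 x.2; have := normr_ge0 y.1; have := normr_ge0 y.2.
  by split; lra.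
pose P m z := forall w x y, w \in words k m -> K x -> K y -> z = Fw k w x ->
  `|phi z - phi (Fw k w y)| <= e.
(* The local statement is joint in the point and the level, so that the covering form of compactness
   yields one level for all of K. Half of d serves for the distance from z to z', half for the size
   of the cell. *)
have near_P z : K z -> \forall z' \near z & m \near \oo, K z' -> P m z'.
  move=> Kz; have /cvgrPdist_lt/(_ (e / 2)) := cphi z Kz.
  move=> /(_ (divr_gt0 e0 (ltr0Sn _ 1))) /nbhs_ballP[d /= d0 zd].
  have k1 : `|k%:R^-1 : R| < 1.
    by rewrite gtr0_norm ?invr_gt0 ?ltr0n; [rewrite invf_lt1 ?ltr0n ?ltr1n //; lia|lia].
  have /cvgrPdist_lt/(_ (d / 2)) := cvg_geometric (2 * M) k1.
  move=> /(_ (divr_gt0 d0 (ltr0Sn _ 1))) small.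
  exists (ball z (d / 2), [set m | `|0 - geometric (2 * M) k%:R^-1 m| < d / 2]).
    by split=> //=; apply/nbhs_ballP; exists (d / 2) => //=; rewrite divr_gt0.
  move=> [z' m] /= [[z1 z2] md] Kz' w x y wm Kx Ky z'E.
  move: (wm); rewrite mem_words => /andP[/eqP sw vw].
  have [D1 D2] := Fw_diff w x y; rewrite -z'E sw in D1 D2.
  have k_ge0 : 0 <= k%:R^-1 ^+ m :> R by rewrite exprn_ge0.
  have M0 : 0 <= 2 * M by rewrite mulr_ge0 // addr_ge0.
  rewrite sub0r normrN /= (ger0_norm (mulr_ge0 M0 k_ge0)) in md.
  have [d1 d2] := diam _ _ Kx Ky.
  have n1 : `|z'.1 - (Fw k w y).1| < d / 2.
    rewrite D1 normrM (ger0_norm k_ge0); apply: le_lt_trans md.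
    exact: ler_wpM2r.
  have n2 : `|z'.2 - (Fw k w y).2| < d / 2.
    rewrite D2 normrM (ger0_norm k_ge0); apply: le_lt_trans md.
    exact: ler_wpM2r.
  rewrite /ball /= in z1 z2.
  have b1 : `|phi z - phi z'| < e / 2.
    by apply: zd => //; split; rewrite /ball /=; lra.
  have b2 : `|phi z - phi (Fw k w y)| < e / 2.
    apply: zd; last exact: SG_Fw.
    split; rewrite /ball /=.
      by rewrite -(subrKA z'.1); apply: le_lt_trans (ler_normD _ _) _; lra.
    by rewrite -(subrKA z'.2); apply: le_lt_trans (ler_normD _ _) _; lra.
  rewrite -(subrKA (phi z)); apply: le_trans (ler_normD _ _) _.
  by rewrite (distrC (phi z')); lra.
have KP := (near_covering_withinP K).2 ((compact_near_coveringP K).1 compK) nat \oo P _ near_P.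
near=> m; have PK : K `<=` P m by near: m; exact: KP.
move=> w x y wm Kx Ky; apply: (PK (Fw k w x) _ w x y) => //.
by apply: SG_Fw => //; move: wm; rewrite mem_words => /andP[].
Unshelve. all: by end_near. Qed.

Lemma continuous_SG_bounded (phi : pt -> R) : {within K, continuous phi} ->
  [bounded phi x | x in K].
Proof.
move=> cphi; have [M [Mr KM]] := compact_bounded (continuous_compact cphi compK).
by exists M; split=> // a Ma x Kx; apply: KM => //; exists x.
Qed.

Variable nu : {measure set pt -> \bar R}.
Hypothesis nuK : (nu K < +oo)%E.
Hypothesis nu_cells : forall m, nu K = (\sum_(w <- words k m) nu (SGcell w))%E.

Lemma continuous_integrable (phi rho : pt -> R) : {within K, continuous phi} ->
  nu.-integrable K (EFin \o rho) -> nu.-integrable K (EFin \o (fun x => phi x * rho x)).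
Proof.
move=> cphi irho.
have -> : EFin \o (fun x => phi x * rho x) = ((EFin \o phi) \* (EFin \o rho))%E.
  by apply/funext => x; rewrite /= EFinM.
apply: integrableMr irho; first exact: compact_measurable_plane.
  exact: continuous_measurable_plane.
exact: continuous_SG_bounded.
Qed.

Lemma Riemann_sum_cvg (phi rho : pt -> R) (x0 : pt) : K x0 ->
  {within K, continuous phi} -> nu.-integrable K (EFin \o rho) ->
  \sum_(w <- words k m) phi (Fw k w x0) * \int[nu]_(x in SGcell w) rho x @[m --> \oo] -->
  \int[nu]_(x in K) (phi x * rho x).
Proof.
move=> Kx0 cphi irho; apply/cvgrPdist_le => e e0.
set I := \int[nu]_(x in K) `|rho x|.
have I0 : 0 <= I by exact: Rintegral_ge0.
(* The summand 1 allows for I = 0. *)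
have e'0 : 0 < e / (I + 1) by rewrite divr_gt0 // ltr_wpDl.
have mK : measurable K by exact: compact_measurable_plane.
have KI w m : w \in words k m -> K `&` SGcell w = SGcell w.
  by rewrite mem_words => /andP[_ vw]; rewrite setIidr //; exact: SGcell_sub.
near=> m.
have -> : \sum_(w <- words k m) phi (Fw k w x0) * \int[nu]_(x in SGcell w) rho x =
    \sum_(w <- words k m) phi (Fw k w x0) * \int[nu]_(x in K `&` SGcell w) rho x.
  by apply: eq_big_seq => w wm; rewrite (KI _ _ wm).
apply: (@le_trans _ _ (e / (I + 1) * I)); last first.
  by rewrite mulrAC ler_pdivrMr ?ltr_wpDl // ler_wpM2l ?(ltW e0) // lerDl.
apply: Riemann_sum_dist => //.
- exact: measurable_SGcell.
- move=> x /(SG_cover_words KSG m)[w [y [wm Ky ->]]].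
  by exists w => //; exists y.
- by rewrite (nu_cells m); apply: eq_big_seq => w wm; rewrite (KI _ _ wm).
- exact: ltW.
- exact: continuous_integrable.
- have osc : forall w x y, w \in words k m -> K x -> K y ->
      `|phi (Fw k w x) - phi (Fw k w y)| <= e / (I + 1).
    by near: m; exact: continuous_small_oscillation.
  by move=> w x wm _ [y Ky <-]; exact: osc.
Unshelve. all: by end_near. Qed.

End SelfSimilarIntegral.

(** [is_density] imposes no sign on [rho]; integrability of its absolute value is drawn from the
    finiteness of its integral, the total mass of [mu]. *)
Lemma density_integrable (R : realType) (mu nu : {measure set (R * R) -> \bar R})
    (rho : R * R -> R) :
  is_density mu nu rho -> (mu setT < +oo)%E -> nu.-integrable setT (EFin \o rho).
Proof.
move=> [mrho murho] muT; apply/integrableP; split; first exact/measurable_EFinP.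
by rewrite integral_fin_num_abs // -murho // ge0_fin_numE.
Qed.

(** * Energy measures and the change of variables by F_j *)

Section Kusuoka.
Variables (R : realType) (k : nat) (K : set (R * R)) (r : R).
Notation pt := (R * R)%type.
Hypotheses (k2 : (2 <= k)%N) (KSG : is_SG k K) (hr : is_renorm k r).
Variables (h : nat -> pt -> R) (nus : nat -> {measure set pt -> \bar R}).
Variables (nu : {measure set pt -> \bar R}) (rho : nat -> pt -> R).
Hypothesis hh : forall l, (l < 3)%N -> harmonic_basis k r K l (h l).
Hypothesis nusE : forall l, (l < 3)%N -> is_energy_measure k r K (h l) (nus l).
Hypothesis nuE : forall A : set pt, measurable A -> nu A = (\sum_(l < 3) nus l A)%E.
Hypothesis rhoE : forall l, (l < 3)%N -> is_density (nus l) nu (rho l).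

Let harmonic_h l : (l < 3)%N -> harmonic k r (h l).
Proof. by move=> /hh[_ []]. Qed.

Let h_corner l j : (l < 3)%N -> (j < 3)%N -> h l (qv R j) = (l == j)%:R.
Proof. by move=> /hh[_ [_ H]] j3; exact: H. Qed.

Let mK : measurable K. Proof. by apply: compact_measurable_plane; case: KSG. Qed.

Lemma energy_measure_cell l w : (l < 3)%N -> valid k w ->
  nus l (SGcell k K w) = (r ^- size w * energy k r (h l \o Fw k w))%:E.
Proof. by move=> /nusE[_ H] vw; exact: H. Qed.

Lemma energy_measure_K l : (l < 3)%N -> nus l K = (corner_form (h l) (h l))%:E.
Proof.
move=> l3; have := @energy_measure_cell l [::] l3 isT.
rewrite (SGcell_nil k K) => ->; rewrite expr0 invr1 mul1r.
by rewrite (harmonic_energy k2 hr (w := [::]) (harmonic_h l3) isT).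
Qed.

(** Additivity over cells is E_m(h_l) = E_0(h_l) in terms of masses: the summands of E_m are the
    masses of the cells of level m. *)
Lemma energy_measure_cells l m : (l < 3)%N ->
  nus l K = (\sum_(w <- words k m) nus l (SGcell k K w))%E.
Proof.
move=> l3; rewrite energy_measure_K // -(Em_0 k2 r) -(harmonic_h l3 m) Em_cells //.
rewrite mulr_sumr -sumEFin; apply: eq_big_seq => w.
rewrite mem_words => /andP[/eqP sw vw].
by rewrite energy_measure_cell // (harmonic_energy k2 hr (harmonic_h l3) vw) sw.
Qed.

Lemma kusuoka_measure_cells m : nu K = (\sum_(w <- words k m) nu (SGcell k K w))%E.
Proof.
rewrite nuE //; under eq_bigr => l _ do rewrite (energy_measure_cells m (ltn_ord l)).
rewrite exchange_big; apply: eq_bigr => w _.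
by rewrite nuE //; exact: measurable_SGcell.
Qed.

Lemma kusuoka_measure_lty : (nu K < +oo)%E.
Proof.
rewrite nuE //; under eq_bigr => l _ do rewrite (energy_measure_K (ltn_ord l)).
by rewrite sumEFin ltry.
Qed.

Lemma kusuoka_density_integrable l : (l < 3)%N -> nu.-integrable K (EFin \o rho l).
Proof.
move=> l3; apply: (@integrableS _ _ _ _ setT) => //.
apply: density_integrable (rhoE l3) _.
apply: (@le_lt_trans _ _ (nus l K + nus l (~` K))%E).
  by rewrite -{1}(setUv K); apply: measureU2 => //; exact: measurableC.
by rewrite (nusE l3).1 adde0 energy_measure_K // ltry.
Qed.

Lemma Rintegral_density_cell l w : (l < 3)%N ->
  \int[nu]_(x in SGcell k K w) rho l x = fine (nus l (SGcell k K w)).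
Proof.
by move=> /rhoE[_ ->] //; exact: measurable_SGcell.
Qed.

(** Masses on [j :: w] carry r^-(|w| + 1); the factor r of [kusuoka_cells] leaves exactly the r^-|w|
    of the masses on [w]. *)
Lemma kusuoka_measure_Sim j w : (j < dk k)%N -> valid k w ->
  fine (nu (SGcell k K (j :: w))) =
  \sum_(i < 3) Scol k r j i * fine (nus i (SGcell k K w)).
Proof.
move=> jk vw; have vjw : valid k (j :: w) by rewrite /= jk.
have r0 : r != 0 by case: hr => r0 _; rewrite gt_eqF.
rewrite nuE; last exact: measurable_SGcell.
under eq_bigr => l _ do rewrite (energy_measure_cell (ltn_ord l) vjw).
rewrite sumEFin /= -mulr_sumr (kusuoka_cells k2 hr harmonic_h h_corner) //.
rewrite exprSr invfM -mulrA mulKf // mulr_sumr; apply: eq_bigr => i _.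
by rewrite (energy_measure_cell (ltn_ord i) vw) /= mulrCA.
Qed.

Let continuousM_within (f g : pt -> R) : {within K, continuous f} ->
  {within K, continuous g} -> {within K, continuous (fun x => f x * g x)}.
Proof. by move=> cf cg x; apply: cvgM; [exact: cf|exact: cg]. Qed.

Let continuous_Sim_within j (f : pt -> R) : (j < dk k)%N ->
  {within K, continuous f} -> {within K, continuous (fun x => f (Sim k j x))}.
Proof.
move=> jk cf; apply/subspace_continuousP => x Kx.
apply: (cvg_comp (Sim k j) f (G := within K (nbhs (Sim k j x)))).
  move=> P wP; have := continuous_Sim wP.
  rewrite /= /within /= !nbhs_simpl /=.
  by apply: filterS => z /= + Kz; apply; exact: SG_Sim.
by move/subspace_continuousP : cf; apply; exact: SG_Sim.
Qed.

(** The Riemann sums agree term by term, level m + 1 on the left with level m on the right: among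
    words of level m + 1 only those starting with j contribute, and there phi(F_j(F_w x0)) = g(F_w
    x0). *)
Lemma kusuoka_integral_Sim j (f v : pt -> R) : (j < dk k)%N ->
  {within K, continuous f} -> {within K, continuous v} -> vanishing v ->
  \int[nu]_(x in K) (f x * glue k K j v x) =
  \sum_(i < 3) Scol k r j i * \int[nu]_(x in K) (f (Sim k j x) * v x * rho i x).
Proof.
move=> jk cf cv v0.
pose phi x := f x * glue k K j v x; pose g x := f (Sim k j x) * v x.
have cphi : {within K, continuous phi}.
  by apply: continuousM_within => //; exact: glue_continuous.
have cfS := continuous_Sim_within jk cf.
have cg : {within K, continuous g} by exact: continuousM_within.
have [x0 Kx0] : K !=set0 by case: KSG => _ [].
(* With density 1, the weight of a cell on the left is its nu-mass. *)
have i1 : nu.-integrable K (EFin \o cst (1 : R)).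
  apply: measurable_bounded_integrable => //; first exact: kusuoka_measure_lty.
  exists 1; split; first exact: num_real.
  by move=> a a1 x _; rewrite /= normr1 ltW.
have Riemann := Riemann_sum_cvg k2 KSG kusuoka_measure_lty kusuoka_measure_cells Kx0.
have := Riemann _ _ cphi i1; rewrite -cvg_shiftS /=.
have -> : (fun m => \sum_(w <- words k m.+1) phi (Fw k w x0) *
      \int[nu]_(x in SGcell k K w) cst 1 x) =
    (fun m => \sum_(i < 3) Scol k r j i * \sum_(w <- words k m) g (Fw k w x0) *
      \int[nu]_(x in SGcell k K w) rho i x).
  apply/funext => m; rewrite big_wordsS (bigD1_seq j) ?mem_iota ?iota_uniq //=.
  rewrite [X in _ + X = _](_ : _ = 0) ?addr0; last first.
    rewrite big_seq_cond big1 // => n; rewrite mem_iota /= => /andP[nk nj].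
    rewrite big_seq big1 // => w.
    rewrite mem_words => /andP[_ vw].
    by rewrite /phi glue_Sim_neq // ?mulr0 ?mul0r //; exact: SG_Fw.
  under [RHS]eq_bigr do rewrite mulr_sumr.
  rewrite [RHS]exchange_big; apply: eq_big_seq => w; rewrite mem_words => /andP[_ vw].
  rewrite Rintegral_cst; last exact: measurable_SGcell.
  rewrite mul1r kusuoka_measure_Sim // mulr_sumr; apply: eq_bigr => i _.
  rewrite Rintegral_density_cell // /phi glue_Sim //; last exact: SG_Fw.
  by rewrite mulrCA.
move=> to_phi.
have to_g : \sum_(i < 3) Scol k r j i * \sum_(w <- words k m) g (Fw k w x0) *
      \int[nu]_(x in SGcell k K w) rho i x @[m --> \oo] -->
    \sum_(i < 3) Scol k r j i * \int[nu]_(x in K) (g x * rho i x).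
  rewrite !big_ord_recl big_ord0; under eq_fun do rewrite !big_ord_recl big_ord0.
  have lim i : (i < 3)%N -> Scol k r j i * (\sum_(w <- words k m) g (Fw k w x0) *
      \int[nu]_(x in SGcell k K w) rho i x) @[m --> \oo] -->
      Scol k r j i * \int[nu]_(x in K) (g x * rho i x).
    by move=> i3; apply: cvgMr; apply: Riemann => //; exact: kusuoka_density_integrable.
  by do !(apply: cvgD; first exact: lim); exact: cvg_cst.
rewrite -(cvg_unique (@Rhausdorff R) to_phi to_g).
by apply: eq_Rintegral => x _; rewrite /= mulr1.
Qed.

Lemma kusuoka_laplacian_Sim j (u f v : pt -> R) : (j < dk k)%N ->
  laplacian k r K nu u f -> in_domE0 k r K v ->
  (energy2 k r (u \o Sim k j) v)%:E =
  (- \int[nu]_(x in K)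
       (r * (\sum_(i < 3) Scol k r j i * rho i x) * f (Sim k j x) * v x)%:E)%E.
Proof.
move=> jk [cf [du uf]] dv; have [[cv _] v0] := dv.
have cg : {within K, continuous (fun x => f (Sim k j x) * v x)}.
  by apply: continuousM_within => //; exact: continuous_Sim_within.
have nuK := kusuoka_measure_lty.
have int_glue : nu.-integrable K (EFin \o (fun x => f x * glue k K j v x)).
  have c : {within K, continuous (fun x => f x * glue k K j v x)}.
    by apply: continuousM_within => //; exact: glue_continuous.
  apply: measurable_bounded_integrable => //; last exact: (continuous_SG_bounded KSG c).
  by apply: continuous_measurable_plane => //; case: KSG.
have int_term i : (i < 3)%N -> nu.-integrable K (EFin \o
    (fun x => r * Scol k r j i * (f (Sim k j x) * v x * rho i x))).
  move=> i3; have := continuous_integrable KSG cg (kusuoka_density_integrable i3).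
  by move=> /(integrableZl mK (r * Scol k r j i)).
have termE x : r * (\sum_(i < 3) Scol k r j i * rho i x) * f (Sim k j x) * v x =
    \sum_(i < 3) r * Scol k r j i * (f (Sim k j x) * v x * rho i x).
  by rewrite mulr_sumr !mulr_suml; apply: eq_bigr => i _; ring.
under eq_integral do rewrite termE.
have int_sum : nu.-integrable K (EFin \o
    (fun x => \sum_(i < 3) r * Scol k r j i * (f (Sim k j x) * v x * rho i x))).
  rewrite (_ : EFin \o _ = (fun x => \sum_(i < 3)
      (r * Scol k r j i * (f (Sim k j x) * v x * rho i x))%:E)%E).
    by apply: (integrable_sum mK) => i _; exact: int_term.
  by apply/funext => x; rewrite /= sumEFin.
have := uf _ (glue_domE0 k2 KSG jk dv).
(* Both extended integrals are finite, so the claim descends to real numbers. *)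
rewrite -(fineK (integrable_fin_num mK int_glue)) -(fineK (integrable_fin_num mK int_sum)).
rewrite -!EFinN => -[uE]; congr EFin.
rewrite (energy2_glue k2 KSG hr jk du dv) uE mulrN; congr (- _).
rewrite -/(Rintegral _ _ _) kusuoka_integral_Sim // mulr_sumr.
rewrite -/(Rintegral _ _ _) Rintegral_sum // => [|i]; last exact: int_term.
apply: eq_bigr => i _; rewrite mulrA RintegralZl //.
exact: (continuous_integrable KSG cg (kusuoka_density_integrable (ltn_ord i))).
Qed.

End Kusuoka.

Theorem theorem2p11 (R : realType) (k : nat) (K : set (R * R)) (r : R)
    (h0 h1 h2 : R * R -> R)
    (nu0 nu1 nu2 nu : {measure set (R * R) -> \bar R})
    (R0 R1 R2 : R * R -> R) (u f : R * R -> R) :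
  (2 <= k)%N ->
  is_SG k K ->
  is_renorm k r ->
  harmonic_basis k r K 0 h0 ->
  harmonic_basis k r K 1 h1 ->
  harmonic_basis k r K 2 h2 ->
  is_energy_measure k r K h0 nu0 ->
  is_energy_measure k r K h1 nu1 ->
  is_energy_measure k r K h2 nu2 ->
  (forall A : set (R * R), measurable A -> nu A = (nu0 A + nu1 A + nu2 A)%E) ->
  is_density nu0 nu R0 ->
  is_density nu1 nu R1 ->
  is_density nu2 nu R2 ->
  laplacian k r K nu u f ->
  forall j : nat, (j < dk k)%N ->
  forall v : R * R -> R, in_domE0 k r K v ->
    (energy2 k r (u \o Sim k j) v)%:E =
    (- \int[nu]_(x in K) (r * Qfun k r j R0 R1 R2 x * f (Sim k j x) * v x)%:E)%E.
Proof.
move=> k2 KSG hr hb0 hb1 hb2 m0 m1 m2 nuE d0 d1 d2 lap j jk v dv.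
pose h l := match l with 0%N => h0 | 1%N => h1 | _ => h2 end.
pose nus l := match l with 0%N => nu0 | 1%N => nu1 | _ => nu2 end.
pose rho l := match l with 0%N => R0 | 1%N => R1 | _ => R2 end.
have hb l : (l < 3)%N -> harmonic_basis k r K l (h l) by case: l => [|[|[|]]].
have ms l : (l < 3)%N -> is_energy_measure k r K (h l) (nus l) by case: l => [|[|[|]]].
have ds l : (l < 3)%N -> is_density (nus l) nu (rho l) by case: l => [|[|[|]]].
have nusE A : measurable A -> nu A = (\sum_(l < 3) nus l A)%E.
  by move=> mA; rewrite nuE // !big_ord_recl big_ord0 adde0 addeA.
rewrite (kusuoka_laplacian_Sim k2 KSG hr hb ms nusE ds jk lap dv).
congr (- _)%E; apply: eq_integral => x _.
by rewrite !big_ord_recl big_ord0 /= addr0 addrA.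
Qed.
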